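(* The following invariant decomposition formula (exotic modular equation) holds: $$\frac{\Psi_2(a_1(z),a_2(z),a_3(z),a_4(z),a_5(z),a_6(z))}{\mathbb{A}_0(a_1(z),a_2(z),a_3(z),a_4(z),a_5(z),a_6(z))^2}=0,$$ where the quadric $\Psi_2(z_1,\dots,z_6):=\mathbb{A}_0^2+\mathbb{A}_1\mathbb{A}_5+\mathbb{A}_2\mathbb{A}_3+\mathbb{A}_4\mathbb{A}_6$ is an invariant associated to $PSL(2,13)$ and $\mathbb{A}_0^2$ is invariant under the action of the image of a Borel subgroup of $PSL(2,13)$ (i.e. a maximal subgroup of order $78$ of $PSL(2,13)$).
   Context: The senary quadratic forms are $\mathbb{A}_0=z_1z_4+z_2z_5+z_3z_6$, $\mathbb{A}_1=z_1^2-2z_3z_4$, $\mathbb{A}_2=-z_5^2-2z_2z_4$, $\mathbb{A}_3=z_2^2-2z_1z_5$, $\mathbb{A}_4=z_3^2-2z_2z_6$, $\mathbb{A}_5=-z_4^2-2z_1z_6$, $\mathbb{A}_6=-z_6^2-2z_3z_5$. With $q=e^{2\pi iz}$, the theta constants for $\Gamma(13)$ are $a_1(z)=q^{121/104}\sum_{n\in\mathbb{Z}}(-1)^nq^{\frac12(13n^2+11n)}$, $a_2(z)=q^{49/104}\sum_n(-1)^nq^{\frac12(13n^2+7n)}$, $a_3(z)=q^{25/104}\sum_n(-1)^nq^{\frac12(13n^2+5n)}$, $a_4(z)=-q^{9/104}\sum_n(-1)^nq^{\frac12(13n^2+3n)}$, $a_5(z)=q^{81/104}\sum_n(-1)^nq^{\frac12(13n^2+9n)}$,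 $a_6(z)=q^{1/104}\sum_n(-1)^nq^{\frac12(13n^2+n)}$. $PSL(2,13)$ acts on $(z_1,\dots,z_6)$ via the six-dimensional representation generated by the matrices $S,T$ (with $\zeta=e^{2\pi i/13}$, $T=\mathrm{diag}(\zeta^7,\zeta^{11},\zeta^8,\zeta^6,\zeta^2,\zeta^5)$ and $S$ as in Proposition 2.5). *)

(* Defs.v *)
(* The complex numbers are [R[i]] for an arbitrary [R : realType]. *)
From HB Require Import structures.
From mathcomp Require Import all_boot all_order all_algebra.
From mathcomp Require Import all_fingroup all_solvable.
From mathcomp Require Import all_classical all_reals all_analysis.
From mathcomp Require Import complex.

Set Implicit Arguments.
Unset Strict Implicit.
Unset Printing Implicit Defensive.

Import Order.TTheory GRing.Theory Num.Theory.
Import numFieldNormedType.Exports.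

Local Open Scope ring_scope.

Section SenaryForms.
Variable K : comNzRingType.
Implicit Type z : 'cV[K]_6.

(* One-based coordinates: [crd z k] is z_k for 1 <= k <= 6. *)
Definition crd z (k : nat) : K := z (inord k.-1) 0.

Definition A0 z := crd z 1 * crd z 4 + crd z 2 * crd z 5 + crd z 3 * crd z 6.
Definition A1 z := crd z 1 ^+ 2 - 2 * crd z 3 * crd z 4.
Definition A2 z := - crd z 5 ^+ 2 - 2 * crd z 2 * crd z 4.
Definition A3 z := crd z 2 ^+ 2 - 2 * crd z 1 * crd z 5.
Definition A4 z := crd z 3 ^+ 2 - 2 * crd z 2 * crd z 6.
Definition A5 z := - crd z 4 ^+ 2 - 2 * crd z 1 * crd z 6.
Definition A6 z := - crd z 6 ^+ 2 - 2 * crd z 3 * crd z 5.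

Definition Psi2 z := A0 z ^+ 2 + A1 z * A5 z + A2 z * A3 z + A4 z * A6 z.

End SenaryForms.

(* The two-sided series sum_(n in Z) u n, for the topology of the norm of K
   (on [R[i]], the modulus): the sum over n >= 0 plus the sum over n < 0,
   where [Negz n] is -(n+1). *)
Definition zseries (K : numFieldType) (u : int -> K) : K :=
  lim (series (fun n : nat => u n%:Z) @ \oo)%classic
  + lim (series (fun n : nat => u (Negz n)) @ \oo)%classic.

Section ThetaConstants.
Variable R : realType.
Local Notation C := R[i].

Definition cexp (w : C) : C :=
  (expR (complex.Re w))%:C%C
  * Complex (cos (complex.Im w)) (sin (complex.Im w)).

(* q^r with q = exp(2 pi i z); for a fractional r this is the branch
   exp(2 pi i r z). *)
Definition qpow (z : C) (r : rat) : C :=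
  cexp (2 * (pi : R)%:C%C * 'i%C * z * ratr r).

(* q^(k^2/104) sum_(n in Z) (-1)^n q^((13 n^2 + k n)/2) *)
Definition theta13 (k : nat) (z : C) : C :=
  qpow z ((k ^ 2)%N%:R / 104)
  * zseries (fun n : int =>
      (-1) ^ n * qpow z ((13 * n ^+ 2 + k%:Z * n)%:Q / 2)).

Definition a1 : C -> C := theta13 11.
Definition a2 : C -> C := theta13 7.
Definition a3 : C -> C := theta13 5.
Definition a4 (z : C) : C := - theta13 3 z.
Definition a5 : C -> C := theta13 9.
Definition a6 : C -> C := theta13 1.

Definition avec (z : C) : 'cV[C]_6 :=
  \col_(i < 6) nth 0 [:: a1 z; a2 z; a3 z; a4 z; a5 z; a6 z] i.

Definition upper_half_plane (z : C) : Prop := 0 < complex.Im z.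

Definition zeta13 : C := cexp (2 * (pi : R)%:C%C * 'i%C / 13).

Definition Tmx : 'M[C]_6 :=
  \matrix_(i < 6, j < 6)
    (zeta13 ^+ nth 0%N [:: 7; 11; 8; 6; 2; 5]%N i *+ (i == j)).

(* The (i,j) entry of S is -(zeta^a - zeta^b)/sqrt 13, where (a,b) is the (i,j)
   entry of this table. *)
Definition Stable : seq (seq (nat * nat)) := [::
  [:: (12, 1); (10, 3); (4, 9);  (5, 8);  (2, 11); (6, 7)];
  [:: (10, 3); (4, 9);  (12, 1); (2, 11); (6, 7);  (5, 8)];
  [:: (4, 9);  (12, 1); (10, 3); (6, 7);  (5, 8);  (2, 11)];
  [:: (5, 8);  (2, 11); (6, 7);  (1, 12); (3, 10); (9, 4)];
  [:: (2, 11); (6, 7);  (5, 8);  (3, 10); (9, 4);  (1, 12)];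
  [:: (6, 7);  (5, 8);  (2, 11); (9, 4);  (1, 12); (3, 10)]]%N.

(* S is determined by a(-1/z) = exp(pi i/4) sqrt(z) S a(z), just as T is by
   a(z+1) = exp(-3 pi i/4) T a(z). *)
Definition Smx : 'M[C]_6 :=
  \matrix_(i < 6, j < 6)
    let ab := nth (0%N, 0%N) (nth [::] Stable i) j in
    - ((Num.sqrt 13 : R)%:C%C)^-1 * (zeta13 ^+ ab.1 - zeta13 ^+ ab.2).

End ThetaConstants.

Definition SL2_13 : {set {'GL_2(13)}} := [set g | \det (GLval g) == 1].

Lemma SL2_13_group_set : group_set SL2_13.
Proof.
apply/group_setP; split=> [|g h]; first by rewrite inE GL_1E det1.
by rewrite !inE GL_MxE det_mulmx => /eqP-> /eqP->; rewrite mulr1.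
Qed.

Canonical SL2_13_group := Group SL2_13_group_set.

Notation PSL2_13 := (SL2_13 / 'Z(SL2_13))%g.

(* The upper triangular Borel subgroup of SL(2,13), i.e. the stabilizer of
   infinity on the projective line. *)
Definition Borel_SL2_13 : {set {'GL_2(13)}} :=
  [set g in SL2_13 | GLval g 1 0 == 0].

Notation Borel_PSL2_13 := (Borel_SL2_13 / 'Z(SL2_13))%g.

Definition mx2 (a b c d : 'F_13) : 'M['F_13]_2 :=
  \matrix_(i < 2, j < 2)
    if i == 0 then (if j == 0 then a else b) else (if j == 0 then c else d).

Lemma det_mx2 a b c d : \det (mx2 a b c d) = a * d - b * c.
Proof.
rewrite (expand_det_row _ ord0) !big_ord_recl big_ord0 /cofactor !det_mx11.
by rewrite !mxE /= expr0 expr1 !mul1r addr0 mulN1r mulrN.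
Qed.

Lemma sgen_unit : mx2 0 (-1) 1 0 \is a GRing.unit.
Proof. by rewrite -[_ \is a _]/(_ \in unitmx) unitmxE det_mx2. Qed.

Lemma tgen_unit : mx2 1 1 0 1 \is a GRing.unit.
Proof. by rewrite -[_ \is a _]/(_ \in unitmx) unitmxE det_mx2. Qed.

(* The elements z |-> -1/z and z |-> z+1 of SL(2,13). *)
Definition sgen : {'GL_2(13)} := FinRing.Unit sgen_unit.
Definition tgen : {'GL_2(13)} := FinRing.Unit tgen_unit.

(* The action of PSL(2,13) on (z_1,...,z_6): [PSL_acts M x] says that the matrix
   M is a representative of x, S and T being representatives of the classes of
   [sgen] and [tgen]; these classes generate PSL(2,13), so every x has a
   representative.  As S^2 = -1 while [sgen] is an involution in PSL(2,13),
   M is determined by x only up to sign; forms of even degree do not see it. *)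
Inductive PSL_acts (R : realType) :
    'M[R[i]]_6 -> coset_of 'Z(SL2_13) -> Prop :=
  | PSL_acts_S : PSL_acts (Smx R) (coset 'Z(SL2_13) sgen)
  | PSL_acts_T : PSL_acts (Tmx R) (coset 'Z(SL2_13) tgen)
  | PSL_acts_1 : PSL_acts 1%:M 1%g
  | PSL_acts_M M N x y :
      PSL_acts M x -> PSL_acts N y -> PSL_acts (M *m N) (x * y)%g
  | PSL_acts_V M x : PSL_acts M x -> PSL_acts (invmx M) (x^-1)%g.

(* f is fixed by every element of the subset X of PSL(2,13). *)
Definition PSL_invariant (R : realType) (X : {set coset_of 'Z(SL2_13)})
    (f : 'cV[R[i]]_6 -> R[i]) : Prop :=
  forall x (M : 'M[R[i]]_6), x \in X -> PSL_acts M x ->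
  forall z, f (M *m z) = f z.

(* Main.v *)
(* Expanding, Psi2 = -2 (z1^3 z6 + z2^3 z4 + z3^3 z5) + 2 (z1 z5^3 + z2 z6^3 + z3 z4^3)
   + 6 (z1 z2 z4 z5 + z1 z3 z4 z6 + z2 z3 z5 z6), and each bracket vanishes at the
   theta constants: a product of two of them is, by the substitution
   (i, j) -> (i + j, i - j) in the double series, a 2 x 2 determinant in the values
   F n = sum_p q^((26 p + n)^2 / 52), and each bracket is a Pluecker relation.
   A0 is nonzero for small q since its leading term is q^(1/4).
   For the invariance, the seven forms A_i span a representation of PSL(2,13), and
   the squares W of 14 of its vectors, among them 13 A0^2 at infinity, are permuted
   like the points of the projective line over F_13; the Borel subgroup fixes
   infinity, and is maximal by the Bruhat decomposition. *)
Require Import Defs.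
From HB Require Import structures.
From mathcomp Require Import all_boot all_order all_algebra.
From mathcomp Require Import all_fingroup all_solvable.
From mathcomp Require Import all_classical all_reals all_analysis.
From mathcomp Require Import complex.
From mathcomp Require Import zify ring lra.
Import numFieldNormedType.Exports.
Import Order.TTheory GRing.Theory Num.Theory.
Local Open Scope ring_scope.

Set Implicit Arguments.
Unset Strict Implicit.
Unset Printing Implicit Defensive.

(** * Unconditional summation: rearrangement, partition and products of series *)

Section UnconditionalSums.
Variable K : numFieldType.
Implicit Types I J : choiceType.

(* Unconditional summation; duplicate-free sequences stand for finite sets. *)
Definition is_sum (I : choiceType) (u : I -> K) (s : K) : Prop :=
  forall e : K, 0 < e -> exists F : seq I, forall t : seq I,
    uniq t -> {subset F <= t} -> `|\sum_(i <- t) u i - s| <= e.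

Lemma is_sum_eq I (u v : I -> K) s : u =1 v -> is_sum u s -> is_sum v s.
Proof.
move=> uv hu e e0; have [F hF] := hu e e0; exists F => t ut Ft.
by under eq_bigr do rewrite -uv; exact: hF.
Qed.

Lemma le_eps_eq (x y c : K) :
  0 <= c -> (forall e, 0 < e -> `|x - y| <= c * e) -> x = y.
Proof.
move=> c0 h; apply/eqP; rewrite -subr_eq0 -normr_le0.
have [c00|cN0] := eqVneq c 0.
  by have := h 1 ltr01; rewrite c00 mul0r.
have {}c0 : 0 < c by rewrite lt_def cN0.
rewrite real_leNgt ?normr_real ?real0 //; apply/negP => p.
have := h (`|x - y| / (2 * c)); rewrite divr_gt0 ?mulr_gt0 // => /(_ isT).
have -> : c * (`|x - y| / (2 * c)) = `|x - y| / 2 by field.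
move=> q.
have : `|x - y| < `|x - y|.
  by apply: (le_lt_trans q); rewrite gtr_pMr ?invf_lt1 ?ltr1n.
by rewrite ltxx.
Qed.

Lemma is_sum_unique I (u : I -> K) s s' : is_sum u s -> is_sum u s' -> s = s'.
Proof.
move=> h h'; apply: (@le_eps_eq _ _ 2) => // e e0.
have [F hF] := h e e0; have [G hG] := h' e e0.
(* A finite set containing both F and G gives a partial sum within [e] of both candidates. *)
have ut := undup_uniq (F ++ G); set t := undup _ in ut.
have /hF {}hF := ut; have /hG {}hG := ut.
have -> : s - s' = (\sum_(i <- t) u i - s') - (\sum_(i <- t) u i - s) by ring.
rewrite mulrDl mul1r (le_trans (ler_normB _ _)) // lerD //.
  by apply: hG => i iG; rewrite mem_undup mem_cat iG orbT.
by apply: hF => i iF; rewrite mem_undup mem_cat iF.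
Qed.

Lemma is_sumD I (u v : I -> K) s s' :
  is_sum u s -> is_sum v s' -> is_sum (fun i => u i + v i) (s + s').
Proof.
move=> h h' e e0; have e20 : 0 < e / 2 by rewrite divr_gt0.
have [F hF] := h _ e20; have [G hG] := h' _ e20.
exists (F ++ G) => t ut st; rewrite big_split /= opprD addrACA.
rewrite [leRHS](splitr e) (le_trans (ler_normD _ _)) // lerD //.
  by apply: hF => // i iF; apply: st; rewrite mem_cat iF.
by apply: hG => // i iG; apply: st; rewrite mem_cat iG orbT.
Qed.

Lemma is_sumZ I (u : I -> K) s c : is_sum u s -> is_sum (fun i => c * u i) (c * s).
Proof.
move=> h e e0; have c1 : 0 < `|c| + 1 by rewrite ltr_wpDl.
have [F hF] := h (e / (`|c| + 1)) (divr_gt0 e0 c1).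
exists F => t ut Ft; rewrite -mulr_sumr -mulrBr normrM.
have := hF _ ut Ft; rewrite ler_pdivlMr // => /(le_trans _); apply.
by rewrite mulrC ler_wpM2l // lerDl.
Qed.

Lemma is_sum_bij I J (f : J -> I) (g : I -> J) (u : I -> K) s :
  cancel f g -> cancel g f -> is_sum u s -> is_sum (u \o f) s.
Proof.
move=> fK gK h e e0; have [F hF] := h e e0.
exists (map g F) => t ut st; rewrite -(big_map f xpredT u).
apply: hF; first by rewrite map_inj_uniq //; exact: can_inj fK.
by move=> i iF; rewrite -(gK i) map_f // st // map_f.
Qed.


(** Serves to cut the lattice Z^2 into two classes, each re-indexed by a copy of [J]; [g0] and [g1]
    have to invert the parametrizations only on their own class. *)
Lemma is_sum_partition I J (P : pred I) (f0 f1 : J -> I) (g0 g1 : I -> J)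
    (u : I -> K) a b :
  cancel f0 g0 -> cancel f1 g1 ->
  (forall j, P (f0 j)) -> (forall j, ~~ P (f1 j)) ->
  (forall i, P i -> f0 (g0 i) = i) -> (forall i, ~~ P i -> f1 (g1 i) = i) ->
  is_sum (u \o f0) a -> is_sum (u \o f1) b -> is_sum u (a + b).
Proof.
move=> f0K f1K Pf0 Pf1 g0K g1K ha hb e e0.
have e20 : 0 < e / 2 by rewrite divr_gt0.
have half (Q : pred I) (f : J -> I) (g : I -> J) c : cancel f g ->
    (forall j, Q (f j)) -> (forall i, Q i -> f (g i) = i) ->
    is_sum (u \o f) c -> exists F : seq I, forall t, uniq t -> {subset F <= t} ->
      `|\sum_(i <- t | Q i) u i - c| <= e / 2.
  move=> fK Qf gK hc; have [F hF] := hc _ e20.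
  exists (map f F) => t ut st.
  rewrite -big_filter.
  have -> : \sum_(i <- seq.filter Q t) u i
      = \sum_(j <- map g (seq.filter Q t)) (u \o f) j.
    rewrite big_map big_seq [RHS]big_seq; apply: eq_bigr => i.
    by rewrite mem_filter /= => /andP[/gK-> _].
  apply: hF.
    rewrite map_inj_in_uniq ?filter_uniq // => i j.
    rewrite !mem_filter => /andP[Qi _] /andP[Qj _] gij.
    by rewrite -(gK i) // gij gK.
  move=> j jF; apply/mapP; exists (f j); last by rewrite fK.
  by rewrite mem_filter Qf st // map_f.
have [F hF] := half P f0 g0 a f0K Pf0 g0K ha.
have [G hG] := half (predC P) f1 g1 b f1K Pf1 g1K hb.
exists (F ++ G) => t ut st; rewrite (bigID P) /= opprD addrACA.
rewrite [leRHS](splitr e) (le_trans (ler_normD _ _)) // lerD //.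
  by apply: hF => // i iF; apply: st; rewrite mem_cat iF.
by apply: hG => // i iG; apply: st; rewrite mem_cat iG orbT.
Qed.

Lemma ler_sum_subset I (u : I -> K) (F t : seq I) :
  (forall i, 0 <= u i) -> uniq F -> uniq t -> {subset F <= t} ->
  \sum_(i <- F) u i <= \sum_(i <- t) u i.
Proof.
move=> u0 uF ut st; rewrite [leRHS](bigID (mem F)) /=.
have -> : \sum_(i <- F) u i = \sum_(i <- t | i \in F) u i.
  rewrite -[RHS]big_filter; apply: perm_big; apply: uniq_perm => //.
    exact: filter_uniq.
  by move=> i; rewrite mem_filter; case: (boolP (i \in F)) => // /st ->.
by rewrite lerDl sumr_ge0.
Qed.

(** Cauchy criterion: the sums over F and over F together with [t] are both within e/2 of [m]. *)
Lemma is_sum_tail I (u : I -> K) m e : is_sum (fun i => `|u i|) m -> 0 < e ->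
  exists F : seq I, uniq F /\ forall t, uniq t -> {in t, forall i, i \notin F} ->
    \sum_(i <- t) `|u i| <= e.
Proof.
move=> h e0; have e20 : 0 < e / 2 by rewrite divr_gt0.
have [F hF] := h _ e20; exists (undup F); split; first exact: undup_uniq.
move=> t ut dt.
have h1 : `|\sum_(i <- undup F) `|u i| - m| <= e / 2.
  by apply: hF (undup_uniq _) _ => i; rewrite mem_undup.
have h2 : `|\sum_(i <- undup F ++ t) `|u i| - m| <= e / 2.
  apply: hF; last by move=> i iF; rewrite mem_cat mem_undup iF.
  rewrite cat_uniq undup_uniq ut andbT /=; apply/hasPn => i /dt //.
rewrite -[leLHS]ger0_norm ?sumr_ge0 //.
have -> : \sum_(i <- t) `|u i| = (\sum_(i <- undup F ++ t) `|u i| - m)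
    - (\sum_(i <- undup F) `|u i| - m) by rewrite big_cat /=; ring.
by rewrite [leRHS](splitr e) (le_trans (ler_normB _ _)) // lerD.
Qed.

Lemma is_sum_bounded I (u : I -> K) m : is_sum (fun i => `|u i|) m ->
  exists M, 0 <= M /\ forall t, uniq t -> \sum_(i <- t) `|u i| <= M.
Proof.
move=> h; have [F [uF hF]] := @is_sum_tail I u m 1 h ltr01.
exists (\sum_(i <- F) `|u i| + 1); split; first by rewrite addr_ge0 ?sumr_ge0.
move=> t ut; rewrite (bigID (mem F)) /= lerD //; last first.
  rewrite -big_filter; apply: hF; first exact: filter_uniq.
  by move=> i; rewrite mem_filter => /andP[].
rewrite -big_filter; apply: ler_sum_subset => //; first exact: filter_uniq.
by move=> i; rewrite mem_filter => /andP[].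
Qed.

Lemma sum_allpairs_mul I J (u : I -> K) (v : J -> K) (F : seq I) (G : seq J) :
  \sum_(p <- [seq (i, j) | i <- F, j <- G]) u p.1 * v p.2
  = (\sum_(i <- F) u i) * (\sum_(j <- G) v j).
Proof.
by rewrite big_allpairs_dep mulr_suml; apply: eq_bigr => i _; rewrite mulr_sumr.
Qed.

(** A finite set H of pairs containing the rectangle F0 x G0 is enclosed in a larger rectangle F x
    G. The sum over F x G factors, and every pair of F x G missing from H has a coordinate outside
    F0 or G0, so the difference is controlled by tails. *)
Lemma is_sum_mul I J (u : I -> K) (v : J -> K) s t m n :
  is_sum u s -> is_sum v t ->
  is_sum (fun i => `|u i|) m -> is_sum (fun j => `|v j|) n ->
  is_sum (fun p => u p.1 * v p.2) (s * t).
Proof.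
move=> us vt um vn e e0.
have [Mu [Mu0 hMu]] := is_sum_bounded um.
have [Mv [Mv0 hMv]] := is_sum_bounded vn.
(* The total error is at most c d: Mu d and d |t| come from the two factors, d Mv + Mu d from the
   pairs outside H. Dividing by c + 1 avoids a zero denominator. *)
pose c := Mu + Mv + Mu + `|t|.
have c1 : 0 < c + 1 by rewrite ltr_wpDl ?addr_ge0.
pose d := e / (c + 1); have d0 : 0 < d by rewrite divr_gt0.
have [F1 hF1] := us d d0; have [F2 [_ hF2]] := is_sum_tail um d0.
have [G1 hG1] := vt d d0; have [G2 [_ hG2]] := is_sum_tail vn d0.
pose F0 := F1 ++ F2; pose G0 := G1 ++ G2.
exists [seq (i, j) | i <- F0, j <- G0] => H uH sH.
pose F := undup (F0 ++ map fst H); pose G := undup (G0 ++ map snd H).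
have uF : uniq F := undup_uniq _; have uG : uniq G := undup_uniq _.
have uFG : uniq [seq (i, j) | i <- F, j <- G].
  by apply: allpairs_uniq => // -[? ?] [? ?].
have HFG : {subset H <= [seq (i, j) | i <- F, j <- G]}.
  move=> [i j] ij; apply/allpairsP; exists (i, j); rewrite !mem_undup !mem_cat.
  by rewrite (map_f fst ij) (map_f snd ij) !orbT.
have F0F : {subset F0 <= F} by move=> i iF; rewrite mem_undup mem_cat iF.
have G0G : {subset G0 <= G} by move=> i iF; rewrite mem_undup mem_cat iF.
set w := fun p : I * J => u p.1 * v p.2.
have split_sum : \sum_(p <- H) w p = \sum_(p <- [seq (i, j) | i <- F, j <- G]) w p
    - \sum_(p <- [seq (i, j) | i <- F, j <- G] | p \notin H) w p.
  rewrite [in RHS](bigID (mem H)) /= addrK -[RHS]big_filter.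
  apply: perm_big; apply: uniq_perm => //; first exact: filter_uniq.
  by move=> p; rewrite mem_filter; case: (boolP (p \in H)) => // /HFG ->.
have tailF : \sum_(i <- F | i \notin F0) `|u i| <= d.
  rewrite -big_filter; apply: hF2; first exact: filter_uniq.
  by move=> i; rewrite mem_filter mem_cat negb_or => /andP[/andP[]].
have tailG : \sum_(i <- G | i \notin G0) `|v i| <= d.
  rewrite -big_filter; apply: hG2; first exact: filter_uniq.
  by move=> i; rewrite mem_filter mem_cat negb_or => /andP[/andP[]].
have rest : `|\sum_(p <- [seq (i, j) | i <- F, j <- G] | p \notin H) w p|
    <= d * Mv + Mu * d.
  apply: (le_trans (ler_norm_sum _ _ _)).
  (* Indicator functions turn the sum over missing pairs into two sums over the whole rectangle,
     which factor. *)
  apply: (@le_trans _ _ (\sum_(p <- [seq (i, j) | i <- F, j <- G])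
     ((p.1 \notin F0)%:R * `|u p.1| * `|v p.2| +
      `|u p.1| * ((p.2 \notin G0)%:R * `|v p.2|)))).
    rewrite big_mkcond /=; apply: ler_sum => -[i j] _ /=.
    case: (boolP ((i, j) \in H)) => ijH /=.
      by rewrite addr_ge0 ?mulr_ge0 ?ler0n.
    rewrite normrM; case: (boolP (i \in F0)) => iF /=; last first.
      by rewrite mul1r lerDl ?mulr_ge0 ?ler0n.
    case: (boolP (j \in G0)) => jG /=; last by rewrite mul1r lerDr !mulr_ge0 ?ler0n.
    by case/negP: ijH; apply: sH; apply/allpairsP; exists (i, j).
  rewrite big_split /= lerD //.
    rewrite (sum_allpairs_mul (fun i => (i \notin F0)%:R * `|u i|) (fun j => `|v j|)).
    apply: ler_pM; [|by apply: sumr_ge0| |exact: hMv].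
      by apply: sumr_ge0 => i _; rewrite mulr_ge0 ?ler0n.
    apply: le_trans tailF; rewrite [leRHS]big_mkcond /=.
    by apply: ler_sum => i _; case: ifP => _; rewrite ?mul1r ?mul0r.
  rewrite (sum_allpairs_mul (fun i => `|u i|) (fun j => (j \notin G0)%:R * `|v j|)).
  apply: ler_pM; [by apply: sumr_ge0| |exact: hMu|].
    by apply: sumr_ge0 => i _; rewrite mulr_ge0 ?ler0n.
  apply: le_trans tailG; rewrite [leRHS]big_mkcond /=.
  by apply: ler_sum => i _; case: ifP => _; rewrite ?mul1r ?mul0r.
have hu : `|\sum_(i <- F) u i - s| <= d.
  by apply: hF1 => // i iF; apply: F0F; rewrite mem_cat iF.
have hv : `|\sum_(i <- G) v i - t| <= d.
  by apply: hG1 => // i iF; apply: G0G; rewrite mem_cat iF.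
have bu : `|\sum_(i <- F) u i| <= Mu.
  by apply: le_trans (ler_norm_sum _ _ _) _; exact: hMu.
rewrite split_sum sum_allpairs_mul.
set X := \sum_(i <- F) u i in hu bu *; set Y := \sum_(j <- G) v j in hv *.
set Z := \sum_(p <- _ | _) w p in rest *.
have -> : X * Y - Z - s * t = X * (Y - t) + (X - s) * t - Z by ring.
apply: (le_trans (ler_normB _ _)); apply: (@le_trans _ _ (c * d)); last first.
  rewrite /d mulrCA ger_pMr // ler_pdivrMr // mul1r lerDl //.
have -> : c * d = (Mu * d + d * `|t|) + (d * Mv + Mu * d) by rewrite /c; ring.
apply: lerD rest; apply: (le_trans (ler_normD _ _)).
by rewrite !normrM lerD // ler_pM.
Qed.

Lemma is_sum_zseries (u : int -> K) s s1 s2 :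
  is_sum u s -> is_sum (fun n : nat => u n%:Z) s1 ->
  is_sum (fun n : nat => u (Negz n)) s2 -> zseries u = s.
Proof.
have nat_cvg (v : nat -> K) l : is_sum v l -> (series v @ \oo --> l)%classic.
  move=> h; apply/cvgrPdist_le => e e0; have [F hF] := h e e0.
  near=> n; rewrite distrC /series /= -[index_iota 0 n]/(iota 0 (n - 0)) subn0.
  apply: hF; first exact: iota_uniq.
  move=> i iF; rewrite mem_iota /= add0n.
  have : (\max_(j <- F) j < n)%N by near: n; exact: nbhs_infty_gt.
  by apply: leq_ltn_trans; exact: (@leq_bigmax_seq _ F xpredT id).
move=> hs h1 h2; rewrite /zseries.
rewrite (cvg_lim _ (nat_cvg _ _ h1)) // (cvg_lim _ (nat_cvg _ _ h2)) //.
have hc := @cvgD _ _ _ _ eventually_filter _ _ _ _ (nat_cvg _ _ h1) (nat_cvg _ _ h2).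
rewrite -(cvg_lim _ hc) //; apply: cvg_lim => //.
apply/cvgrPdist_le => e e0; have [F hF] := hs e e0.
near=> n; rewrite distrC.
change (`|\sum_(i <- iota 0 (n - 0)) u i%:Z
          + \sum_(i <- iota 0 (n - 0)) u (Negz i) - s| <= e).
rewrite subn0.
(* The two n-th partial sums together run over the integers from -n to n - 1, and these contain F
   once n exceeds every |i| in F. *)
rewrite -(big_map Posz xpredT u) -(big_map Negz xpredT u) -big_cat /=.
have nF : (\max_(j <- F) `|j|%N < n)%N by near: n; exact: nbhs_infty_gt.
apply: hF.
  rewrite cat_uniq !map_inj_uniq ?iota_uniq //=; last 2 first.
  - by move=> i j [].
  - by move=> i j [].
  by rewrite andbT; apply/hasPn => _ /mapP[i _ ->]; apply/mapP => -[].
move=> i iF; have ni : (`|i|%N < n)%N.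
  by apply: leq_ltn_trans nF; exact: (@leq_bigmax_seq _ F xpredT absz).
rewrite mem_cat; case: i {iF} ni => i /= ni.
  by rewrite mem_map ?mem_iota ?add0n ?ni // => ? ? [].
by rewrite orbC mem_map ?mem_iota /= ?add0n ?(ltnW ni) // => ? ? [].
Unshelve. all: by end_near.
Qed.

End UnconditionalSums.

(** * Summability of real and complex families; geometric domination *)

Section ComplexSums.
Variable R : realType.
Local Notation C := R[i].

(** The sum is the supremum of the finite partial sums. *)
Lemma is_sum_ge0 (I : choiceType) (u : I -> R) (M : R) :
  (forall i, 0 <= u i) -> (forall t, uniq t -> \sum_(i <- t) u i <= M) ->
  exists s, is_sum u s.
Proof.
move=> u0 uM.
pose E := [set x | exists t : seq I, uniq t /\ x = \sum_(i <- t) u i]%classic.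
have supE : has_sup E.
  split; first by exists (\sum_(i <- [::]) u i); exists [::].
  by exists M => _ [t [ut ->]]; exact: uM.
exists (sup E) => e e0.
have [_ [F [uF ->]] hF] := sup_adherent e0 supE.
exists F => t ut Ft; rewrite ler_distl; apply/andP; split.
  by rewrite (le_trans (ltW hF)) // ler_sum_subset.
apply: (@le_trans _ _ (sup E)); last by rewrite lerDl ltW.
by apply: ub_le_sup; [case: supE | exists t].
Qed.

Lemma is_sum_bounded_real (I : choiceType) (u : I -> R) (M : R) :
  (forall t, uniq t -> \sum_(i <- t) `|u i| <= M) -> exists s, is_sum u s.
Proof.
move=> uM.
(* Reduces to the positive and negative parts (|u| + u)/2 and (|u| - u)/2. *)
have part (v : I -> R) : (forall i, 0 <= v i <= `|u i|) -> exists s, is_sum v s.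
  move=> hv; apply: (@is_sum_ge0 _ _ M) => [i|t ut]; first by case/andP: (hv i).
  by apply: le_trans (uM t ut); apply: ler_sum => i _; case/andP: (hv i).
have [i|s1 h1] := part (fun i => (`|u i| + u i) / 2).
  by case: (ler0P (u i)) => ?; lra.
have [i|s2 h2] := part (fun i => (`|u i| - u i) / 2).
  by case: (ler0P (u i)) => ?; lra.
exists (s1 + (-1) * s2); apply: is_sum_eq (is_sumD h1 (is_sumZ (-1) h2)) => i /=.
lra.
Qed.

Lemma is_sum_real_complex (I : choiceType) (u : I -> R) s :
  is_sum u s -> is_sum (fun i => (u i)%:C%C) (s%:C%C).
Proof.
move=> h e e0; have eE : e = (complex.Re e)%:C%C by rewrite RRe_real ?gtr0_real.
have {}e0 : 0 < complex.Re e by rewrite -ltcR -eE.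
have [F hF] := h _ e0; exists F => t ut Ft.
by rewrite -rmorph_sum -rmorphB /= normc_def /= expr0n /= addr0 sqrtr_sqr eE lecR hF.
Qed.

Lemma is_sum_bounded_complex (I : choiceType) (u : I -> C) (b : I -> R) (M : R) :
  (forall i, `|u i| <= (b i)%:C%C) -> (forall t, uniq t -> \sum_(i <- t) b i <= M) ->
  (exists s, is_sum u s) /\ (exists s, is_sum (fun i => `|u i|) s).
Proof.
move=> ub bM.
have bnd (v : I -> R) : (forall i, `|v i| <= b i) -> exists s, is_sum v s.
  move=> hv; apply: (@is_sum_bounded_real _ _ M) => t ut.
  by apply: le_trans (bM t ut); apply: ler_sum.
have [i|s1 h1] := bnd (fun i => complex.Re (u i)).
  by rewrite -lecR (le_trans (normc_ge_Re _)).
have [i|s2 h2] := bnd (fun i => complex.Im (u i)).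
  rewrite -lecR; apply: le_trans (ub i).
  (* Im u is, up to sign, the real part of i u, and multiplication by i keeps the modulus. *)
  have := normc_ge_Re (u i * 'i%C).
  have -> : `|u i * 'i%C| = `|u i|.
    by rewrite normrM [X in _ * X]normc_def /= expr0n expr1n add0r sqrtr1 mulr1.
  by rewrite ReiNIm normrN.
have [i|s3 h3] := bnd (fun i => complex.Re `|u i|).
  rewrite ger0_norm; first by rewrite -lecR RRe_real ?normr_real.
  by rewrite -lecR RRe_real ?normr_real ?normr_ge0.
split.
  exists (s1%:C%C + 'i%C * s2%:C%C).
  apply: is_sum_eq (is_sumD (is_sum_real_complex h1)
     (is_sumZ 'i%C (is_sum_real_complex h2))) => i /=.
  by rewrite -complexE.
exists s3%:C%C; apply: is_sum_eq (is_sum_real_complex h3) => i.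
by rewrite RRe_real ?normr_real.
Qed.

Lemma geometric_uniq_nat (x : R) (t : seq nat) : 0 <= x < 1 -> uniq t ->
  \sum_(n <- t) x ^+ n <= (1 - x)^-1.
Proof.
case/andP=> x0 x1 ut; set N := (\max_(n <- t) n).+1.
apply: (@le_trans _ _ (\sum_(n <- iota 0 N) x ^+ n)).
  apply: ler_sum_subset (iota_uniq _ _) _ => // [n|n nt]; first exact: exprn_ge0.
  by rewrite mem_iota add0n ltnS (@leq_bigmax_seq _ t xpredT id).
rewrite -[iota 0 N]/(index_iota 0 N) big_mkord.
have y0 : 0 < 1 - x by rewrite subr_gt0.
rewrite -[leRHS]div1r ler_pdivlMr // mulrC -[X in X * _]opprB mulNr -subrX1 opprB.
by rewrite gerBl exprn_ge0.
Qed.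

Lemma geometric_uniq_int (x : R) (t : seq int) : 0 <= x < 1 -> uniq t ->
  \sum_(n <- t) x ^+ `|n|%N <= 2 / (1 - x).
Proof.
move=> x01 ut; rewrite (bigID (fun n : int => 0 <= n)) /= mulrDl mul1r.
have half (P : pred int) : 
    (forall m n, P m -> P n -> absz m = absz n -> m = n) ->
    \sum_(n <- t | P n) x ^+ `|n|%N <= (1 - x)^-1.
  move=> injP; rewrite -big_filter -(big_map absz xpredT (fun n => x ^+ n)).
  apply: geometric_uniq_nat => //; rewrite map_inj_in_uniq ?filter_uniq //.
  by move=> m n; rewrite !mem_filter => /andP[Pm _] /andP[Pn _]; exact: injP.
by apply: lerD; apply: half => m n /=; lia.
Qed.

Lemma is_sum_geometric (u : int -> C) (M x : R) : 0 <= x < 1 ->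
  (forall n, `|u n| <= (M * x ^+ `|n|%N)%:C%C) ->
  [/\ is_sum u (zseries u) & exists s, is_sum (fun n => `|u n|) s].
Proof.
move=> x01 hu.
have M0 : 0 <= M.
  have := le_trans (normr_ge0 _) (hu 0).
  by rewrite -[0 in X in X <= _]/(0%:C%C) lecR mulr1.
(* The injection [f] lets one bound serve Z itself and its two halves, embedded by [Posz] and
   [Negz]. *)
have bnd (J : choiceType) (f : J -> int) : injective f ->
    forall t, uniq t -> \sum_(j <- t) M * x ^+ `|f j|%N <= M * (2 / (1 - x)).
  move=> injf t ut; rewrite -mulr_sumr ler_wpM2l //.
  rewrite -(big_map f xpredT (fun n => x ^+ `|n|%N)) geometric_uniq_int //.
  by rewrite map_inj_uniq.
have [[s hs] ha] := is_sum_bounded_complex hu (bnd _ _ (@inj_id int)).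
have injP : injective Posz by move=> m n [].
have injN : injective Negz by move=> m n [].
have [[s1 h1] _] := is_sum_bounded_complex (fun n : nat => hu n%:Z) (bnd nat _ injP).
have [[s2 h2] _] :=
  is_sum_bounded_complex (fun n : nat => hu (Negz n)) (bnd nat _ injN).
by split=> //; rewrite (is_sum_zseries hs h1 h2).
Qed.

End ComplexSums.

(* Psi2 is a combination of three quartics, each of which is a three-term
   Weierstrass relation, i.e. the Pluecker relation for the 2 x 2 determinants
   F a * F b - F (a + 13) * F (b + 13), with F even and of period 26. *)
Lemma Psi2_weierstrass (K : comNzRingType) (t F : nat -> K) (z : 'cV[K]_6) :
  (forall k l a b a' b' : nat,
    [&& k == a + b, a == l + b, (a' == a + 13) || (a' + a == 13)
      & (b' == b + 13) || (b' + b == 13)]%N ->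
    t k * t l = F a * F b - F a' * F b') ->
  crd z 1 = t 11%N -> crd z 2 = t 7%N -> crd z 3 = t 5%N ->
  crd z 4 = - t 3%N -> crd z 5 = t 9%N -> crd z 6 = t 1%N ->
  Psi2 z = 0.
Proof.
move=> tM e1 e2 e3 e4 e5 e6.
have q1 : t 11 * t 11 * (t 11 * t 1) - t 7 * t 7 * (t 7 * t 3)
    + t 5 * t 5 * (t 9 * t 5) = 0.
  (* In [tM k l a b a' b'], a and b are the half sum and half difference of k and l, while a' and b'
     are a + 13 and b + 13 or their reflections 13 - a and 13 - b. *)
  rewrite (tM 11 11 11 0 2 13) // (tM 11 1 6 5 7 8) // (tM 7 7 7 0 6 13) //.
  by rewrite (tM 7 3 5 2 8 11) // (tM 5 5 5 0 8 13) // (tM 9 5 7 2 6 11) //; ring.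
have q2 : t 11 * t 9 * (t 9 * t 9) + t 7 * t 1 * (t 1 * t 1)
    - t 5 * t 3 * (t 3 * t 3) = 0.
  rewrite (tM 11 9 10 1 3 12) // (tM 9 9 9 0 4 13) // (tM 7 1 4 3 9 10) //.
  by rewrite (tM 1 1 1 0 12 13) // (tM 5 3 4 1 9 12) // (tM 3 3 3 0 10 13) //; ring.
have q3 : - (t 11 * t 7) * (t 9 * t 3) - t 11 * t 3 * (t 5 * t 1)
    + t 9 * t 5 * (t 7 * t 1) = 0.
  rewrite (tM 11 7 9 2 4 11) // (tM 9 3 6 3 7 10) // (tM 11 3 7 4 6 9) //.
  by rewrite (tM 5 1 3 2 10 11) // (tM 9 5 7 2 6 11) // (tM 7 1 4 3 9 10) //; ring.
(* The three brackets of the expanded quartic, with z4 = - t 3 accounting for the signs. *)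
have -> : Psi2 z = -2 * (t 11 * t 11 * (t 11 * t 1) - t 7 * t 7 * (t 7 * t 3)
    + t 5 * t 5 * (t 9 * t 5)) + 2 * (t 11 * t 9 * (t 9 * t 9)
    + t 7 * t 1 * (t 1 * t 1) - t 5 * t 3 * (t 3 * t 3))
    + 6 * (- (t 11 * t 7) * (t 9 * t 3) - t 11 * t 3 * (t 5 * t 1)
    + t 9 * t 5 * (t 7 * t 1)).
  by rewrite /Psi2 /A0 /A1 /A2 /A3 /A4 /A5 /A6 e1 e2 e3 e4 e5 e6; ring.
by rewrite q1 q2 q3 !mulr0 !addr0.
Qed.

(** * Theta series, their product formula and the vanishing of [Psi2] *)

Section Thetas.
Variable R : realType.
Local Notation C := R[i].

Lemma cexpD (v w : C) : cexp (v + w) = cexp v * cexp w.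
Proof.
case: v w => a b [c d]; rewrite /cexp /= expRD cosD sinD; simpc.
by congr Complex; ring.
Qed.

Lemma norm_cexp (w : C) : `|cexp w| = (expR (complex.Re w))%:C%C.
Proof.
rewrite /cexp normrM !normc_def /= expr0n /= addr0 sqrtr_sqr cos2Dsin2 sqrtr1 mulr1.
by rewrite ger0_norm ?expR_ge0.
Qed.

Variable z : C.

(** For d = 104 the exponent is k^2/104 + (13 n^2 + k n)/2, a completed square that absorbs the
    prefactor of [theta13]; d = 52 occurs in products of two such series. *)
Definition gauss (d : nat) (k n : int) : C :=
  qpow z (((26 * n + k) ^+ 2)%:Q / d%:R).

Lemma gauss_eq d (k l m n : int) :
  26 * m + k = 26 * n + l \/ 26 * m + k = - (26 * n + l) ->
  gauss d k m = gauss d l n.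
Proof. by rewrite /gauss => -[] ->; rewrite ?sqrrN. Qed.

Lemma qpow_arg (r : rat) : 2 * (pi : R)%:C%C * 'i%C * z * ratr r
  = Complex (- (2 * pi * complex.Im z) * ratr r) (2 * pi * complex.Re z * ratr r).
Proof.
rewrite -(fmorph_rat (real_complex R)) /=; case: z => x y.
rewrite -[2 : C](rmorph_nat (real_complex R)) /=; simpc.
by congr Complex; ring.
Qed.

Lemma qpowD (r s : rat) : qpow z (r + s) = qpow z r * qpow z s.
Proof. by rewrite /qpow -cexpD -mulrDr -(rmorphD (ratr : rat -> C)). Qed.

Lemma norm_qpow (r : rat) :
  `|qpow z r| = (expR (- (2 * pi * complex.Im z) * ratr r))%:C%C.
Proof. by rewrite norm_cexp qpow_arg. Qed.

Lemma qpow0 : qpow z 0 = 1.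
Proof.
rewrite /qpow qpow_arg rmorph0 !mulr0 /cexp /= expR0 cos0 sin0.
by simpc.
Qed.

Hypothesis z_uhp : upper_half_plane z.

Let c : R := 2 * pi * complex.Im z.

Let c_gt0 : 0 < c.
Proof. by rewrite !mulr_gt0 ?pi_gt0. Qed.

Lemma norm_expN1z (n : int) : `|(-1) ^ n| = 1 :> C.
Proof. by rewrite expN1r normrX normrN1 expr1n. Qed.

(* (26 n + k)^2 >= 26 |n| - |k| bounds a Gaussian series by a geometric one. *)
Lemma norm_gauss_le (d : nat) (k n : int) : (0 < d)%N ->
  `|gauss d k n|
  <= (expR (c / d%:R * `|k|%:~R) * expR (- (c / d%:R * 26)) ^+ `|n|%N)%:C%C.
Proof.
move=> d0; rewrite /gauss norm_qpow lecR -expRM_natr -expRD ler_expR.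
rewrite fmorph_div /= ratr_int ratr_nat.
have cd : 0 < c / d%:R by rewrite divr_gt0 ?ltr0n.
have -> : - (2 * pi * complex.Im z) * (((26 * n + k) ^+ 2)%:~R / d%:R)
  = - (c / d%:R * ((26 * n + k) ^+ 2)%:~R) by rewrite /c; ring.
have -> : c / d%:R * `|k|%:~R + - (c / d%:R * 26) * `|n|%N%:R =
   - (c / d%:R * (26 * `|n| - `|k|)%:~R).
  rewrite rmorphB rmorphM /= -abszE pmulrn; ring.
rewrite lerN2 ler_pM2l // ler_int; nia.
Qed.

Let x_lt1 d : (0 < d)%N -> 0 <= expR (- (c / d%:R * 26)) < 1.
Proof.
by move=> d0; rewrite expR_ge0 expR_lt1 oppr_lt0 mulr_gt0 ?divr_gt0 ?ltr0n.
Qed.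

Definition odd_theta (k : int) : C :=
  zseries (fun n => (-1) ^ n * gauss 104 k n).

Definition even_theta (k : int) : C :=
  zseries (fun n => gauss 52 k n).

Lemma is_sum_odd_theta k :
  let u := fun n : int => (-1) ^ n * gauss 104 k n in
  is_sum u (odd_theta k) /\ exists s, is_sum (fun n => `|u n|) s.
Proof.
move=> u.
have hu n : `|u n| <=
    (expR (c / 104 * `|k|%:~R) * expR (- (c / 104 * 26)) ^+ `|n|%N)%:C%C.
  rewrite /u normrM norm_expN1z mul1r.
  exact: (norm_gauss_le k n (isT : (0 < 104)%N)).
by case: (is_sum_geometric (x_lt1 (isT : (0 < 104)%N)) hu).
Qed.

Lemma is_sum_even_theta k :
  let u := fun n : int => gauss 52 k n in
  is_sum u (even_theta k) /\ exists s, is_sum (fun n => `|u n|) s.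
Proof.
move=> u.
have hu n := norm_gauss_le k n (isT : (0 < 52)%N).
by case: (is_sum_geometric (x_lt1 (isT : (0 < 52)%N)) hu).
Qed.

(** The prefactor completes the square. Before it can be moved into [zseries], the inner series [w]
    must be known to converge; its bound is the one for [gauss] divided by the modulus of the
    prefactor. *)
Lemma theta13E (k : nat) : theta13 k z = odd_theta k%:Z.
Proof.
have [hk _] := is_sum_odd_theta k%:Z.
have q0 : qpow z ((k ^ 2)%N%:R / 104) != 0.
  by rewrite -normr_gt0 norm_qpow -[0]/(0%:C%C) ltcR expR_gt0.
have uE (n : int) : (-1) ^ n * gauss 104 k%:Z n
  = qpow z ((k ^ 2)%N%:R / 104)
    * ((-1) ^ n * qpow z ((13 * n ^+ 2 + k%:Z * n)%:Q / 2)).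
  rewrite [RHS]mulrCA /gauss -qpowD; congr (_ * qpow z _).
  by rewrite natrX !(rmorph_nat, rmorphD, rmorphM, rmorphXn) /= ?pmulrn; field.
pose w (n : int) : C := (-1) ^ n * qpow z ((13 * n ^+ 2 + k%:Z * n)%:Q / 2).
have hw n : `|w n| <= ((expR (- c * ratr ((k ^ 2)%N%:R / 104)))^-1
    * expR (c / 104 * `|k%:Z|%:~R) * expR (- (c / 104 * 26)) ^+ `|n|%N)%:C%C.
  have -> : w n = (qpow z ((k ^ 2)%N%:R / 104))^-1
      * ((-1) ^ n * gauss 104 k%:Z n).
    by rewrite uE mulKf.
  have := norm_gauss_le k%:Z n (isT : (0 < 104)%N).
  rewrite /gauss norm_qpow lecR => h.
  rewrite [leLHS]normrM normfV norm_qpow normrM norm_expN1z mul1r norm_qpow.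
  rewrite -fmorphV -rmorphM lecR -[leRHS]mulrA.
  by apply: ler_wpM2l h; rewrite invr_ge0 expR_ge0.
have [h _] := is_sum_geometric (x_lt1 (isT : (0 < 104)%N)) hw.
rewrite /theta13.
apply: (is_sum_unique (is_sumZ _ h)).
by apply: is_sum_eq hk => n; exact: uE.
Qed.

Lemma even_thetaN k : even_theta (- k) = even_theta k.
Proof.
have [h1 _] := is_sum_even_theta (- k); have [h2 _] := is_sum_even_theta k.
apply: (is_sum_unique h1).
apply: is_sum_eq (is_sum_bij (@opprK int) (@opprK int) h2) => n /=.
by apply: gauss_eq; right; ring.
Qed.

(** Evenness combined with the shift of n by 1, which changes k by 26. *)
Lemma even_theta26B k : even_theta (26 - k) = even_theta k.
Proof.
rewrite -even_thetaN opprB.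
have [h1 _] := is_sum_even_theta (k - 26); have [h2 _] := is_sum_even_theta k.
apply: (is_sum_unique h1).
apply: is_sum_eq (is_sum_bij (@subrK int 1) (@addrK int 1) h2) => n /=.
by apply: gauss_eq; left; ring.
Qed.

(* The change of variables (i, j) = (p + r + e, p - r), e = 0, 1, splits the
   lattice Z^2 according to the parity of i - j. *)
Lemma odd_theta_mul (a b : int) :
  odd_theta (a + b) * odd_theta (a - b)
  = even_theta a * even_theta b - even_theta (a + 13) * even_theta (b + 13).
Proof.
have [hk [sk hka]] := is_sum_odd_theta (a + b).
have [hl [sl hla]] := is_sum_odd_theta (a - b).
have [ha [sa haa]] := is_sum_even_theta a.
have [hb [sb hba]] := is_sum_even_theta b.
have [ha' [sa' haa']] := is_sum_even_theta (a + 13).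
have [hb' [sb' hba']] := is_sum_even_theta (b + 13).
apply: (is_sum_unique (is_sum_mul hk hl hka hla)).
have hE := is_sum_mul ha hb haa hba.
have hO := is_sumZ (-1) (is_sum_mul ha' hb' haa' hba').
rewrite -[- (_ * _)]mulN1r.
apply: (@is_sum_partition _ _ _ (fun x : int * int => ~~ odd `|x.1 - x.2|)
  (fun x : int * int => (x.1 + x.2, x.1 - x.2))
  (fun x : int * int => (x.1 + x.2 + 1, x.1 - x.2))
  (fun x : int * int => (((x.1 + x.2) %/ 2)%Z, ((x.1 - x.2) %/ 2)%Z))
  (fun x : int * int => (((x.1 + x.2 - 1) %/ 2)%Z, ((x.1 - x.2 - 1) %/ 2)%Z))).
- by case=> i j /=; congr (_, _); lia.
- by case=> i j /=; congr (_, _); lia.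
- by case=> i j /=; lia.
- by case=> i j /=; lia.
- by case=> i j /= h; congr (_, _); lia.
- by case=> i j /= h; congr (_, _); lia.
(* With X = 26 p + a and Y = 26 r + b this is (X + Y)^2 + (X - Y)^2 = 2 X^2 + 2 Y^2; the sign is 1
   because i + j = 2 p. *)
- apply: is_sum_eq hE => -[p r] /=.
  rewrite [RHS]mulrACA /gauss -!qpowD !expN1r -exprD -signr_odd.
  have -> : odd (`|p + r| + `|p - r|) = false by lia.
  rewrite mul1r; congr qpow.
  by rewrite !(rmorph_nat, rmorphD, rmorphM, rmorphXn, rmorphN) /=; field.
(* The same identity with X = 26 p + a + 13 and Y = 26 r + b + 13; now i + j = 2 p + 1, whence the
   minus sign. *)
- apply: is_sum_eq hO => -[p r] /=.
  rewrite [RHS]mulrACA /gauss -!qpowD !expN1r -exprD -signr_odd.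
  have -> : odd (`|p + r + 1| + `|p - r|) = true by lia.
  congr (_ * qpow _ _).
  by rewrite !(rmorph_nat, rmorphD, rmorphM, rmorphXn, rmorphN) /=; field.
Qed.

Lemma avecE (k : 'I_6) : avec z k 0 =
  nth 0 [:: odd_theta 11; odd_theta 7; odd_theta 5; - odd_theta 3;
            odd_theta 9; odd_theta 1] k.
Proof. by rewrite mxE /a1 /a2 /a3 /a4 /a5 /a6 !theta13E. Qed.

Lemma Psi2_avec : Psi2 (avec z) = 0.
Proof.
pose F (n : nat) := even_theta n%:Z; pose t (n : nat) := odd_theta n%:Z.
(* The reflection k -> 26 - k takes n + 13 to 13 - n, which keeps the indices of F natural
   numbers. *)
have F13 (n m : nat) : (m == n + 13)%N || (m + n == 13)%N ->
    even_theta (n%:Z + 13) = F m.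
  case/orP=> /eqP h; first by rewrite /F h.
  by rewrite /F -even_theta26B; congr even_theta; lia.
apply: (@Psi2_weierstrass _ t F); try by rewrite /crd avecE inordK.
move=> k l a b a' b' /and4P[/eqP-> /eqP al /F13<- /F13<-].
by rewrite -odd_theta_mul; congr (_ * odd_theta _); lia.
Qed.

End Thetas.

(** * Nonvanishing of [A0] at a point of the upper half plane *)

Section Nonvanishing.
Variable R : realType.
Local Notation C := R[i].
Local Notation normc := ComplexField.Normc.normc.

Let le_normcC (x : C) (r : R) : (`|x| <= r%:C%C) = (normc x <= r).
Proof. by rewrite -lecR. Qed.

(** Since k <= 11, the exponent (13 n^2 + k n)/2 is at least |n|, so the series is dominated by
    q^|n| and the term n = 0, equal to 1, prevails. *)
Lemma zseries_near1 (z : C) (k : nat) : (k <= 11)%N ->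
  let q := expR (- (2 * pi * complex.Im z)) in q <= 1 / 200 ->
  normc (zseries (fun n : int =>
    (-1) ^ n * qpow z ((13 * n ^+ 2 + k%:Z * n)%:Q / 2)) - 1) <= 1 / 10.
Proof.
move=> k11 q q1; set w := fun n : int => _.
have q0 : 0 <= q by exact: expR_ge0.
have nw n : `|w n| <= (1 * q ^+ `|n|%N)%:C%C.
  rewrite /w normrM norm_expN1z !mul1r norm_qpow lecR -expRM_natr ler_expR.
  rewrite fmorph_div /= ratr_int ratr_nat !mulNr lerN2.
  have c0 : 0 <= 2 * pi * complex.Im z.
    by rewrite -oppr_le0 -[leRHS]/(0 : R) -expR_le1 (le_trans q1) //; lra.
  apply: ler_wpM2l => //.
  rewrite ler_pdivlMr // pmulrn -[2]/(2%:~R) -rmorphM /= ler_int; nia.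
have q01 : 0 <= q < 1 by lra.
have [hw _] := is_sum_geometric q01 nw.
have e0 : 0 < (1 / 50)%:C%C :> C by rewrite -[0]/(0%:C%C) ltcR; lra.
have [F hF] := hw _ e0; set s := zseries w in hw hF *.
have ut := undup_uniq (0 :: F); set t := undup _ in ut.
have Ft : {subset F <= t} by move=> i iF; rewrite mem_undup in_cons iF orbT.
have t0 : 0 \in t by rewrite mem_undup mem_head.
have := hF t ut Ft; rewrite le_normcC => h1.
have w0 : w 0 = 1 by rewrite /w expr0z mul1r expr0n !mulr0 addr0 mul0r qpow0.
have tail : normc (\sum_(n <- t) w n - 1) <= 8 * q.
  rewrite -le_normcC (bigD1_seq 0) //= w0 addrAC subrr add0r.
  apply: (le_trans (ler_norm_sum _ _ _)).
  (* For n != 0, q^|n| <= q (1/2)^(|n| - 1); the sum of (1/2)^|n| over Z is bounded by 4, which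
     gives 8 q. *)
  apply: (@le_trans _ _ (\sum_(n <- t) (2 * q * (1 / 2) ^+ `|n|%N)%:C%C)).
    rewrite big_mkcond /=; apply: ler_sum => n _; case: ifP => n0.
      apply: (le_trans (nw n)); rewrite lecR mul1r.
      have -> : `|n|%N = `|n|.-1.+1 by rewrite prednK // absz_gt0.
      rewrite !exprS mulrA; have -> : 2 * q * (1 / 2) = q by field.
      rewrite ler_wpM2l // lerXn2r ?nnegrE //; lra.
    by rewrite -[0]/(0%:C%C) lecR mulr_ge0 ?exprn_ge0 //; lra.
  rewrite -rmorph_sum lecR -mulr_sumr.
  have -> : 8 * q = 2 * q * (2 / (1 - 1 / 2)) by field.
  have h12 : 0 <= (1 / 2 : R) < 1 by apply/andP; split; lra.
  by apply: ler_wpM2l; [lra | exact: geometric_uniq_int].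
have -> : s - 1 = (\sum_(n <- t) w n - 1) - (\sum_(n <- t) w n - s) by ring.
apply: (le_trans (le_normcD _ _)); rewrite normcN; lra.
Qed.

Lemma A0_avec_neq0 : exists z : C, upper_half_plane z /\ A0 (avec z) != 0.
Proof.
pose z : C := Complex 0 50; exists z; split; first by rewrite /upper_half_plane /=.
(* From pi >= 2 and exp x >= 1 + x at x = 100 pi. *)
have q1 : expR (- (2 * pi * complex.Im z)) <= 1 / 200 :> R.
  have p2 : 2 <= pi :> R by exact: pi_ge2.
  rewrite expRN div1r lef_pV2 ?posrE ?expR_gt0 //.
  have := expR_ge1Dx (2 * pi * complex.Im z : R); rewrite /=; lra.
pose al k := zseries (fun n : int =>
    (-1) ^ n * qpow z ((13 * n ^+ 2 + k%:Z * n)%:Q / 2)).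
have al1 k : (k <= 11)%N -> normc (al k - 1) <= 1 / 10.
  by move=> k11; exact: zseries_near1.
have al2 k : (k <= 11)%N -> normc (al k) <= 11 / 10.
  move=> /al1 h; rewrite -[al k](subrK 1); apply: (le_trans (le_normcD _ _)).
  by rewrite ComplexField.Normc.normc1; lra.
have thE k : theta13 k z = qpow z ((k ^ 2)%N%:R / 104) * al k by [].
clearbody al.
rewrite /A0 /crd /avec !mxE !inordK //= /a1 /a2 /a3 /a4 /a5 /a6 !thE.
set X := (X in X != 0).
(* Exponents over 104: 25 + 1 = 26 gives q^(1/4), while 49 + 81 = 121 + 9 = 130 gives q^(5/4). *)
have -> : X = qpow z (1 / 4) * (al 5 * al 1
    + qpow z 1 * (al 7 * al 9 - al 11 * al 3)).
  have alg (p1 p3 p5 p7 p9 p11 b1 b3 b5 b7 b9 b11 q4 q1' : C) :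
      p5 * p1 = q4 -> p7 * p9 = q4 * q1' -> p11 * p3 = q4 * q1' ->
      p11 * b11 * - (p3 * b3) + p7 * b7 * (p9 * b9) + p5 * b5 * (p1 * b1)
      = q4 * (b5 * b1 + q1' * (b7 * b9 - b11 * b3)).
    move=> e1 e2 e3; transitivity (p5 * p1 * (b5 * b1) + p7 * p9 * (b7 * b9)
      - p11 * p3 * (b11 * b3)); first by ring.
    by rewrite e1 e2 e3; ring.
  by apply: alg; rewrite -!qpowD; congr qpow; field.
have nq r : qpow z r != 0.
  by rewrite -normr_gt0 norm_qpow -[0]/(0%:C%C) ltcR expR_gt0.
rewrite mulf_neq0 //; apply/eqP => h.
have nq1 : normc (qpow z 1) <= 1 / 200.
  by rewrite -le_normcC norm_qpow lecR rmorph1 mulr1.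
move: (qpow z 1) nq1 h => q' nq1 h.
(* If the bracket vanished, its difference from 1 would have modulus 1; the estimates bound that
   modulus by 0.11 + 0.1 + 0.0121. *)
have : normc ((al 5 - 1) * al 1 + (al 1 - 1)
    + q' * (al 7 * al 9 - al 11 * al 3)) = 1.
  have -> : (al 5 - 1) * al 1 + (al 1 - 1)
    + q' * (al 7 * al 9 - al 11 * al 3) = -1.
    by rewrite -[RHS]addr0 -h; ring.
  by rewrite normcN ComplexField.Normc.normc1.
have prod x y (a b : R) : normc x <= a -> normc y <= b -> normc (x * y) <= a * b.
  move=> hx hy; rewrite ComplexField.Normc.normcM ler_pM //.
    by rewrite -lecR; exact: (normr_ge0 x).
  by rewrite -lecR; exact: (normr_ge0 y).
have b1 := prod _ _ _ _ (al1 5%N isT) (al2 1%N isT).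
have b2 := al1 1%N isT.
have b3 : normc (al 7 * al 9 - al 11 * al 3) <= 11 / 10 * (11 / 10) + 11 / 10 * (11 / 10).
  by apply: (le_trans (le_normcD _ _)); rewrite normcN lerD // prod // al2.
have b4 := prod _ _ _ _ nq1 b3.
have b5 := le_normcD ((al 5 - 1) * al 1) (al 1 - 1).
have b6 := le_normcD ((al 5 - 1) * al 1 + (al 1 - 1))
   (q' * (al 7 * al 9 - al 11 * al 3)).
by move=> b7; lra.
Qed.

End Nonvanishing.

(** * The Borel subgroup of PSL(2,13): order and maximality *)

Section BorelSubgroup.

Lemma ord2E (i : 'I_2) : (i == 0) || (i == 1).
Proof. by case: i => -[|[|]]. Qed.

Lemma mx2P (A : 'M['F_13]_2) a b c d : A 0 0 = a -> A 0 1 = b ->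
  A 1 0 = c -> A 1 1 = d -> A = mx2 a b c d.
Proof.
move=> <- <- <- <-; apply/matrixP => i j; rewrite mxE.
by case/orP: (ord2E i) => /eqP->; case/orP: (ord2E j) => /eqP->.
Qed.

Lemma mulmx2E (A B : 'M['F_13]_2) i j :
  (A *m B) i j = A i 0 * B 0 j + A i 1 * B 1 j.
Proof.
rewrite mxE !big_ord_recl big_ord0 addr0.
by congr (_ + A i _ * B _ j); exact: val_inj.
Qed.

Lemma SL2P (g : {'GL_2(13)}) :
  reflect (GLval g 0 0 * GLval g 1 1 - GLval g 0 1 * GLval g 1 0 = 1) (g \in SL2_13).
Proof.
rewrite inE; set A := GLval g.
by rewrite (@mx2P A _ _ _ _ erefl erefl erefl erefl) det_mx2 !mxE; exact: eqP.
Qed.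

Lemma GL2_eq (g h : {'GL_2(13)}) : GLval g 0 0 = GLval h 0 0 ->
  GLval g 0 1 = GLval h 0 1 -> GLval g 1 0 = GLval h 1 0 ->
  GLval g 1 1 = GLval h 1 1 -> g = h.
Proof.
by move=> *; apply: val_inj; rewrite [LHS](mx2P erefl erefl erefl erefl);
  apply/esym/mx2P.
Qed.

Lemma sgen_SL : sgen \in SL2_13.
Proof. by rewrite inE /= det_mx2. Qed.

Lemma tgen_SL : tgen \in SL2_13.
Proof. by rewrite inE /= det_mx2. Qed.

Lemma in_Borel g : (g \in Borel_SL2_13) = (g \in SL2_13) && (GLval g 1 0 == 0).
Proof. by rewrite finset.in_set. Qed.

Lemma Borel_group_set : group_set Borel_SL2_13.
Proof.
apply/group_setP; split=> [|g h].
  by rewrite in_Borel (group1 SL2_13_group) GL_1E mxE.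
rewrite !in_Borel => /andP[gS /eqP g0] /andP[hS /eqP h0].
rewrite (@groupM _ SL2_13_group) //.
by rewrite GL_MxE mulmx2E g0 h0 mul0r mulr0 addr0 eqxx.
Qed.

Canonical Borel_group := Group Borel_group_set.

Lemma borel_mx_unit (a b : 'F_13) : a != 0 -> mx2 a b 0 a^-1 \is a GRing.unit.
Proof.
move=> a0; rewrite -[_ \is a _]/(_ \in unitmx) unitmxE det_mx2 mulr0 subr0.
by rewrite divff ?unitr1.
Qed.

(** The junk value 1 at a = 0, where the matrix is singular, makes the parametrization total. *)
Definition borel_elt (a b : 'F_13) : {'GL_2(13)} :=
  if boolP (a != 0) is AltTrue a0 then FinRing.Unit (borel_mx_unit b a0) else 1%g.

Lemma borel_eltE a b : a != 0 -> GLval (borel_elt a b) = mx2 a b 0 a^-1.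
Proof. by rewrite /borel_elt; case: {-}_ / boolP => // /negP. Qed.

Lemma borel_elt_Borel a b : a != 0 -> borel_elt a b \in Borel_SL2_13.
Proof.
move=> a0; rewrite in_Borel (borel_eltE b a0) mxE eqxx andbT.
by apply/SL2P; rewrite (borel_eltE b a0) !mxE /= mulr0 subr0 divff.
Qed.

Lemma Borel_SLE : Borel_SL2_13 =
  [set borel_elt p.1 p.2 | p in finset.setX [set~ (0 : 'F_13)] [set: 'F_13]].
Proof.
apply/setP => g; apply/idP/imsetP => [|[[a b]]]; last first.
  rewrite finset.in_setX => /andP[a0 _] ->; apply: borel_elt_Borel.
  by move: a0; rewrite !inE.
rewrite in_Borel => /andP[/SL2P gS /eqP g0]; rewrite g0 mulr0 subr0 in gS.
have a0 : GLval g 0 0 != 0.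
  by apply/eqP => h; move: gS; rewrite h mul0r => /esym/eqP; rewrite oner_eq0.
exists (GLval g 0 0, GLval g 0 1); first by rewrite !inE andbT.
apply: GL2_eq; rewrite (borel_eltE _ a0) !mxE //=.
by apply: (mulfI a0); rewrite gS divff.
Qed.

Lemma card_Borel_SL : #|Borel_SL2_13| = 156%N.
Proof.
rewrite Borel_SLE card_in_imset; first by rewrite cardsX cardsC1 cardsT card_Fp.
move=> [a b] [a' b']; rewrite !inE !andbT /= => a0 a0' /(congr1 (@GLval _ _)).
rewrite !borel_eltE // => /matrixP h.
by have := h 0 0; have := h 0 1; rewrite !mxE /= => -> ->.
Qed.

(** Commuting with [sgen] and [tgen] already forces a scalar matrix, and the determinant makes the
    scalar a square root of 1. *)
Lemma center_SLP g : g \in 'Z(SL2_13)%g -> [/\ GLval g 1 0 = 0, GLval g 0 1 = 0,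
  GLval g 1 1 = GLval g 0 0 & GLval g 0 0 ^+ 2 = 1].
Proof.
case/centerP => gS gC.
have /(congr1 (@GLval _ _)) := gC _ tgen_SL.
have /(congr1 (@GLval _ _)) := gC _ sgen_SL.
rewrite !GL_MxE => /matrixP hs /matrixP ht.
have := hs 0 0; rewrite !mulmx2E /= !mxE /= !(mulr0, mulr1, mul0r, mul1r, add0r, addr0).
have := ht 0 0; rewrite !mulmx2E /= !mxE /= !(mulr0, mulr1, mul0r, mul1r, add0r, addr0).
have := ht 0 1; rewrite !mulmx2E /= !mxE /= !(mulr0, mulr1, mul0r, mul1r, add0r, addr0).
move=> h1 h2 h3.
have c0 : GLval g 1 0 = 0 by apply: (addrI (GLval g 0 0)); rewrite -h2 addr0.
have ad : GLval g 1 1 = GLval g 0 0.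
  by apply: (addrI (GLval g 0 1)); rewrite -h1 addrC.
have b0 : GLval g 0 1 = 0 by rewrite h3 c0 mulN1r oppr0.
by move/SL2P: gS; rewrite c0 mulr0 subr0 ad -expr2.
Qed.

Lemma center_SL : 'Z(SL2_13)%g = [set borel_elt 1 0; borel_elt (-1) 0].
Proof.
have N1 : (-1 : 'F_13) != 0 by [].
apply/setP => g; apply/idP/idP.
  case/center_SLP => c0 b0 ad /eqP; rewrite -subr_eq0 subr_sqr_1 mulf_eq0.
  rewrite subr_eq0 addr_eq0 !inE => /orP[] /eqP a1; apply/orP; [left|right]; apply/eqP.
    by apply: GL2_eq; rewrite borel_eltE ?oner_eq0 // !mxE /= ?ad ?a1 ?invr1.
  by apply: GL2_eq; rewrite borel_eltE // !mxE /= ?ad ?a1 ?invrN1.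
case/finset.set2P => ->; apply/centerP; split.
- by have := borel_elt_Borel 0 (oner_neq0 _); rewrite in_Borel => /andP[].
- by move=> h _; apply: GL2_eq; rewrite !GL_MxE borel_eltE ?oner_eq0 // !mulmx2E !mxE
    /= ?invr1 !(mulr0, mulr1, mul0r, mul1r, add0r, addr0).
- by have := borel_elt_Borel 0 N1; rewrite in_Borel => /andP[].
- by move=> h _; apply: GL2_eq; rewrite !GL_MxE borel_eltE // !mulmx2E !mxE
    /= ?invrN1 !(mulr0, mulrN1, mul0r, mulN1r, add0r, addr0).
Qed.

Lemma center_sub_Borel : 'Z(SL2_13)%g \subset Borel_SL2_13.
Proof.
apply/fintype.subsetP => g gZ; have [c0 _ _ _] := center_SLP gZ.
by rewrite in_Borel c0 eqxx andbT (fintype.subsetP (center_sub _) _ gZ).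
Qed.

Lemma Borel_sub_SL : Borel_SL2_13 \subset SL2_13.
Proof. by apply/fintype.subsetP => g; rewrite in_Borel => /andP[]. Qed.

Lemma SL_norm_center : SL2_13 \subset 'N('Z(SL2_13))%g.
Proof. exact: gFnorm. Qed.

(** The centre has order 2 and lies in the Borel subgroup, so the order is 156/2. *)
Lemma card_Borel_PSL : #|Borel_PSL2_13| = 78%N.
Proof.
rewrite card_quotient; last exact: fintype.subset_trans Borel_sub_SL SL_norm_center.
rewrite -(@divgS _ Borel_group 'Z(SL2_13)%G center_sub_Borel) /= card_Borel_SL.
rewrite center_SL cards2; case: eqP => // /(congr1 (@GLval _ _)).
by rewrite !borel_eltE ?oner_eq0 // => /matrixP /(_ 0 0); rewrite !mxE.
Qed.

Lemma coset_Borel g b : g \in SL2_13 -> b \in Borel_SL2_13 ->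
  coset 'Z(SL2_13)%g g = coset 'Z(SL2_13)%g b -> g \in Borel_SL2_13.
Proof.
move=> gS bB e; have bS := fintype.subsetP Borel_sub_SL _ bB.
have nZ x : x \in SL2_13 -> x \in 'N('Z(SL2_13))%g.
  exact: (fintype.subsetP SL_norm_center).
have [x xZ ->] := kercoset_rcoset (nZ _ gS) (nZ _ bS) e.
by rewrite (@groupM _ Borel_group) //; exact: (fintype.subsetP center_sub_Borel).
Qed.

Lemma SL2_Bruhat g : g \in SL2_13 -> g \notin Borel_SL2_13 ->
  exists b1 b2, [/\ b1 \in Borel_SL2_13, b2 \in Borel_SL2_13 & g = (b1 * sgen * b2)%g].
Proof.
move=> gS; have /SL2P gd := gS; rewrite in_Borel gS /= => c0.
set a := GLval g 0 0 in gd; set b := GLval g 0 1 in gd.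
set c := GLval g 1 0 in gd c0; set d := GLval g 1 1 in gd.
(* [sgen] sends infinity to 0 and the translation by a/c carries 0 to a/c, the image of infinity
   under g; the right factor fixes infinity and supplies the bottom row (c, d). *)
exists (borel_elt 1 (a / c)), (borel_elt c d); split;
  rewrite ?borel_elt_Borel ?oner_eq0 //.
apply: GL2_eq; rewrite !GL_MxE !borel_eltE ?oner_eq0 // !mulmx2E !mxE /= -/a -/b -/c -/d.
- by rewrite ?invr1 !(mulr0, mulr1, mul0r, mul1r, add0r, addr0) divfK.
- rewrite ?invr1 !(mulr0, mulr1, mul0r, mul1r, add0r, addr0) mulN1r.
  by apply: (mulIf c0); rewrite mulrDl mulNr mulVf // mulrAC divfK // -gd; ring.
- by rewrite ?invr1 !(mulr0, mulr1, mul0r, mul1r, add0r, addr0).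
- by rewrite ?invr1 !(mulr0, mulr1, mul0r, mul1r, add0r, addr0).
Qed.

(** If a proper subgroup H above the Borel subgroup had an element b1 s b2 outside it, H would
    contain s, hence every double coset element, contradicting properness. *)
Lemma maximal_Borel_PSL : maximal Borel_PSL2_13 PSL2_13.
Proof.
have BS : Borel_PSL2_13 \subset PSL2_13 by exact: quotientS Borel_sub_SL.
apply/(@maxgroupP _ _ (Borel_group / 'Z(SL2_13))%G); split=> /=.
  rewrite properE BS /=; apply/negP => /fintype.subsetP sub.
  have /sub : coset 'Z(SL2_13)%g sgen \in PSL2_13 by exact: (mem_quotient _ sgen_SL).
  case/morphimP => b _ bB e; have := coset_Borel sgen_SL bB e.
  by rewrite in_Borel sgen_SL /= mxE.
move=> H /properP[HS [x xS xH]] BH; apply/eqP.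
rewrite finset.eqEsubset BH andbT; apply/fintype.subsetP => y yH.
have /morphimP[g gN gS yE] := fintype.subsetP HS _ yH.
rewrite yE; have [gB|gB] := boolP (g \in Borel_SL2_13).
  exact: (@mem_quotient _ _ _ Borel_group).
have nZ h : h \in SL2_13 -> h \in 'N('Z(SL2_13))%g.
  exact: (fintype.subsetP SL_norm_center).
have BinH b : b \in Borel_SL2_13 -> coset 'Z(SL2_13)%g b \in H.
  by move=> bB; apply: (fintype.subsetP BH); exact: (@mem_quotient _ _ _ Borel_group).
have NB b : b \in Borel_SL2_13 -> b \in 'N('Z(SL2_13))%g.
  by move=> bB; apply/nZ/(fintype.subsetP Borel_sub_SL).
have Ns := nZ _ sgen_SL.
have sH : coset 'Z(SL2_13)%g sgen \in H.
  have [b1 [b2 [b1B b2B ge]]] := SL2_Bruhat gS gB.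
  move: yH; rewrite yE ge (morphM _ (groupM (NB _ b1B) Ns) (NB _ b2B)).
  by rewrite (morphM _ (NB _ b1B) Ns) 
    (groupMr _ (BinH _ b2B)) (groupMl _ (BinH _ b1B)).
case/negP: xH; have /morphimP[h hN hS ->] := xS.
have [hB|hB] := boolP (h \in Borel_SL2_13); first exact: BinH.
have [b1 [b2 [b1B b2B ->]]] := SL2_Bruhat hS hB.
rewrite (morphM _ (groupM (NB _ b1B) Ns) (NB _ b2B)) (morphM _ (NB _ b1B) Ns).
by rewrite (groupMr _ (BinH _ b2B)) (groupMl _ (BinH _ b1B)).
Qed.

End BorelSubgroup.

(** * The matrices S and T acting on the forms A_i, as identities modulo the 13th cyclotomic
    polynomial *)

Section SenaryAction.
Variables (K : comNzRingType) (x : K).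
Hypothesis cyclo : x ^+ 12 = - (1 + x + x ^+ 2 + x ^+ 3 + x ^+ 4 + x ^+ 5 + x ^+ 6
  + x ^+ 7 + x ^+ 8 + x ^+ 9 + x ^+ 10 + x ^+ 11).
Implicit Type z : 'cV[K]_6.

Lemma cyclo13 : x ^+ 13 = 1.
Proof. by ring: cyclo. Qed.

(* -sqrt 13 times the matrix S *)
Definition Stab : 'M[K]_6 := \matrix_(i < 6, j < 6)
  let ab := nth (0%N, 0%N) (nth [::] Stable i) j in x ^+ ab.1 - x ^+ ab.2.

Definition Tdiag : 'M[K]_6 := \matrix_(i < 6, j < 6)
  (x ^+ nth 0%N [:: 7; 11; 8; 6; 2; 5]%N i *+ (i == j)).

Lemma sum_ord6 (F : 'I_6 -> K) : \sum_j F j = F (inord 0) + F (inord 1)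
  + F (inord 2) + F (inord 3) + F (inord 4) + F (inord 5).
Proof.
rewrite !big_ord_recr /= big_ord0 add0r.
by congr (F _ + F _ + F _ + F _ + F _ + F _); apply: val_inj; rewrite /= inordK.
Qed.

Lemma crd_Stab z k : (0 < k <= 6)%N ->
  let e j := let ab := nth (0%N, 0%N) (nth [::] Stable k.-1) j in
    x ^+ ab.1 - x ^+ ab.2 in
  crd (Stab *m z) k = e 0%N * crd z 1 + e 1%N * crd z 2 + e 2%N * crd z 3
    + e 3%N * crd z 4 + e 4%N * crd z 5 + e 5%N * crd z 6.
Proof.
case: k => // k k6 e; rewrite /crd mxE sum_ord6.
by rewrite !mxE !inordK.
Qed.

Lemma crd_Tdiag z k : (0 < k <= 6)%N ->
  crd (Tdiag *m z) k = x ^+ nth 0%N [:: 7; 11; 8; 6; 2; 5]%N k.-1 * crd z k.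
Proof.
case: k => // k k6; rewrite /crd mxE (bigD1 (inord k)) //= big1 ?addr0.
  by rewrite mxE inordK // eqxx.
by move=> j jk; rewrite mxE eq_sym (negbTE jk) mul0r.
Qed.

(* The quadratic Gauss sum mod 13; its square is 13. *)
Definition gauss_sum : K := x - x ^+ 2 + x ^+ 3 + x ^+ 4 - x ^+ 5 - x ^+ 6 - x ^+ 7
  - x ^+ 8 + x ^+ 9 + x ^+ 10 - x ^+ 11 + x ^+ 12.

Ltac A_Stab_tac :=
  rewrite /A0 /A1 /A2 /A3 /A4 /A5 /A6 !crd_Stab //= /gauss_sum; ring: cyclo.

(** The seven identities from here on show that S preserves the span of the A_i. For i, j >= 1 the
    coefficient of A_j in the image of A_i is x^m + x^(-m) with m^2 = 4 w_i w_j mod 13, where w =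
    (1, 4, 9, 3, 12, 10) lists the weights under T. *)
Lemma A0_Stab z : A0 (Stab *m z)
  = gauss_sum * (A0 z + A1 z + A2 z + A3 z + A4 z + A5 z + A6 z).
Proof. by A_Stab_tac. Qed.

Lemma A1_Stab z : A1 (Stab *m z) = gauss_sum * (2 * A0 z
  + (x ^+ 2 + x ^+ 11) * A1 z + (x ^+ 4 + x ^+ 9) * A2 z + (x ^+ 6 + x ^+ 7) * A3 z
  + (x ^+ 5 + x ^+ 8) * A4 z + (x ^+ 3 + x ^+ 10) * A5 z + (x ^+ 1 + x ^+ 12) * A6 z).
Proof. by A_Stab_tac. Qed.

Lemma A2_Stab z : A2 (Stab *m z) = gauss_sum * (2 * A0 z
  + (x ^+ 4 + x ^+ 9) * A1 z + (x ^+ 5 + x ^+ 8) * A2 z + (x ^+ 1 + x ^+ 12) * A3 z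
  + (x ^+ 3 + x ^+ 10) * A4 z + (x ^+ 6 + x ^+ 7) * A5 z + (x ^+ 2 + x ^+ 11) * A6 z).
Proof. by A_Stab_tac. Qed.

Lemma A3_Stab z : A3 (Stab *m z) = gauss_sum * (2 * A0 z
  + (x ^+ 6 + x ^+ 7) * A1 z + (x ^+ 1 + x ^+ 12) * A2 z + (x ^+ 5 + x ^+ 8) * A3 z
  + (x ^+ 2 + x ^+ 11) * A4 z + (x ^+ 4 + x ^+ 9) * A5 z + (x ^+ 3 + x ^+ 10) * A6 z).
Proof. by A_Stab_tac. Qed.

Lemma A4_Stab z : A4 (Stab *m z) = gauss_sum * (2 * A0 z
  + (x ^+ 5 + x ^+ 8) * A1 z + (x ^+ 3 + x ^+ 10) * A2 z + (x ^+ 2 + x ^+ 11) * A3 z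
  + (x ^+ 6 + x ^+ 7) * A4 z + (x ^+ 1 + x ^+ 12) * A5 z + (x ^+ 4 + x ^+ 9) * A6 z).
Proof. by A_Stab_tac. Qed.

Lemma A5_Stab z : A5 (Stab *m z) = gauss_sum * (2 * A0 z
  + (x ^+ 3 + x ^+ 10) * A1 z + (x ^+ 6 + x ^+ 7) * A2 z + (x ^+ 4 + x ^+ 9) * A3 z
  + (x ^+ 1 + x ^+ 12) * A4 z + (x ^+ 2 + x ^+ 11) * A5 z + (x ^+ 5 + x ^+ 8) * A6 z).
Proof. by A_Stab_tac. Qed.

Lemma A6_Stab z : A6 (Stab *m z) = gauss_sum * (2 * A0 z
  + (x ^+ 1 + x ^+ 12) * A1 z + (x ^+ 2 + x ^+ 11) * A2 z + (x ^+ 3 + x ^+ 10) * A3 z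
  + (x ^+ 4 + x ^+ 9) * A4 z + (x ^+ 5 + x ^+ 8) * A5 z + (x ^+ 6 + x ^+ 7) * A6 z).
Proof. by A_Stab_tac. Qed.

Definition A_Stab := (A0_Stab, A1_Stab, A2_Stab, A3_Stab, A4_Stab, A5_Stab, A6_Stab).

Lemma A_Tdiag z : [/\ A0 (Tdiag *m z) = A0 z, A1 (Tdiag *m z) = x * A1 z,
  A2 (Tdiag *m z) = x ^+ 4 * A2 z & A3 (Tdiag *m z) = x ^+ 9 * A3 z] /\
  [/\ A4 (Tdiag *m z) = x ^+ 3 * A4 z, A5 (Tdiag *m z) = x ^+ 12 * A5 z
    & A6 (Tdiag *m z) = x ^+ 10 * A6 z].
Proof.
by split; split; rewrite /A0 /A1 /A2 /A3 /A4 /A5 /A6 !crd_Tdiag //=; ring: cyclo13.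
Qed.

(** The relation S^2 = -1 rescaled, from which S is invertible. *)
Lemma Stab2 : Stab *m Stab = (- 13)%:M.
Proof.
have h z : Stab *m (Stab *m z) = (- 13) *: z.
  apply/matrixP => i j; rewrite (ord1 j) {j}.
  have crdE (y : 'cV[K]_6) : y i 0 = crd y i.+1 by rewrite /crd inord_val.
  rewrite [RHS]mxE !crdE; case: i {crdE} => i /= i6.
  do 6? [case: i i6 => [_|i i6] //; first by rewrite !crd_Stab //=; ring: cyclo].
apply/matrixP => i j.
have := congr1 (fun v : 'cV_6 => v i 0) (h (delta_mx j 0)).
by rewrite mulmxA -colE !mxE mulr_natr eqxx andbT.
Qed.

Lemma Psi2_Stab z : Psi2 (Stab *m z) = 169 * Psi2 z.
Proof. by rewrite /Psi2 !A_Stab /gauss_sum; ring: cyclo. Qed.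

(** The weights of the paired forms add up to 13: 1 + 12, 4 + 9, 3 + 10. *)
Lemma Psi2_Tdiag z : Psi2 (Tdiag *m z) = Psi2 z.
Proof.
have [[t0 t1 t2 t3] [t4 t5 t6]] := A_Tdiag z.
by rewrite /Psi2 t0 t1 t2 t3 t4 t5 t6; ring: cyclo13.
Qed.

(* The exponents 0, 1, 4, 9, 3, 12, 10 are the weights of the A_i under T. *)
Definition phi (n : nat) z : K := A0 z + x ^+ (n %% 13) * A1 z
  + x ^+ (4 * n %% 13) * A2 z + x ^+ (9 * n %% 13) * A3 z + x ^+ (3 * n %% 13) * A4 z
  + x ^+ (12 * n %% 13) * A5 z + x ^+ (10 * n %% 13) * A6 z.

Lemma phi_Tdiag n z : phi n (Tdiag *m z) = phi (n.+1 %% 13) z.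
Proof.
have [[t0 t1 t2 t3] [t4 t5 t6]] := A_Tdiag z.
rewrite /phi t0 t1 t2 t3 t4 t5 t6 !modnMmr modn_mod !(expr_mod _ cyclo13) !mulnS.
by rewrite !(exprD, exprS) expr0; ring.
Qed.

Lemma phi0_Stab z : phi 0 (Stab *m z) = 13 * gauss_sum * A0 z.
Proof. by rewrite /phi /= !A_Stab /gauss_sum; ring: cyclo. Qed.

(** Tabulates -1/v so that the exponents in [phi] become numerals; the entry at 0 is a filler. *)
Lemma F13_oppV (v : 'F_13) : v != 0 ->
  nat_of_ord (- v^-1) = nth 0%N [:: 0; 12; 6; 4; 3; 5; 2; 11; 8; 10; 9; 7; 1]%N v.
Proof. by case: v; do 13? [case=> //]; move=> *; vm_compute. Qed.

(** Before squaring, the factor is 13 times the Legendre symbol of v: plus on the squares 1, 3, 4,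
    9, 10, 12 and minus on the other classes. *)
Lemma phi_Stab_sqr (v : 'F_13) z : v != 0 ->
  phi v (Stab *m z) ^+ 2 = 169 * phi (- v^-1) z ^+ 2.
Proof.
have sq (a b : K) : a = 13 * b \/ a = - 13 * b -> a ^+ 2 = 169 * b ^+ 2.
  by case=> ->; ring.
move=> v0; rewrite (F13_oppV v0); apply: sq.
have n13 := ltn_ord v; have : (nat_of_ord v != 0)%N by [].
move: (nat_of_ord v) n13 => n n13 {v v0}.
rewrite /phi !A_Stab /gauss_sum => n0.
have : n \in [:: 1; 3; 4; 9; 10; 12]%N \/ n \in [:: 2; 5; 6; 7; 8; 11]%N.
  by case: n n13 n0; do 13? [case=> //]; rewrite ?inE /=; auto.
case=> h; [left|right]; move: h; rewrite !inE.
  by do 5? [case/orP]; move=> /eqP-> /=; ring: cyclo.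
by do 5? [case/orP]; move=> /eqP-> /=; ring: cyclo.
Qed.

(* [W c d] is the square of the form attached to the point d/c of the projective
   line over F_13, the point at infinity being c = 0. *)
Definition W (c d : 'F_13) z : K :=
  if c == 0 then 13 * A0 z ^+ 2 else phi (d / c) z ^+ 2.

(** (c, c + d) is the row vector (c, d) times [tgen]; likewise (d, -c) below is (c, d) times
    [sgen]. *)
Lemma W_Tdiag c d z : W c d (Tdiag *m z) = W c (c + d) z.
Proof.
rewrite /W; case: eqP => [_|/eqP c0]; first by have [[-> _ _ _] _] := A_Tdiag z.
by rewrite phi_Tdiag mulrDl divff // addrC.
Qed.

(** S exchanges infinity and 0, and the factor 13 in [W] at infinity makes both directions scale by
    169, as the remaining points do. *)
Lemma W_Stab c d z : (c, d) != (0, 0) -> W c d (Stab *m z) = 169 * W d (- c) z.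
Proof.
have g2 : gauss_sum ^+ 2 = 13 by rewrite /gauss_sum; ring: cyclo.
rewrite xpair_eqE negb_and /W; case: eqP => [c0 d0|/eqP c0 _].
  have {}d0 : d != 0 := d0.
  have -> : - c / d = 0 by rewrite c0 mulNr mul0r oppr0.
  rewrite (negbTE d0) A0_Stab exprMn g2.
  by rewrite /phi /= !expr0; ring.
case: eqP => [->|/eqP d0]; first by rewrite mul0r phi0_Stab !exprMn g2; ring.
by rewrite phi_Stab_sqr ?mulf_neq0 ?invr_eq0 // invf_div mulNr.
Qed.

Lemma A_scale (a : K) z : [/\ A0 (a *: z) = a ^+ 2 * A0 z, A1 (a *: z) = a ^+ 2 * A1 z,
  A2 (a *: z) = a ^+ 2 * A2 z & A3 (a *: z) = a ^+ 2 * A3 z] /\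
  [/\ A4 (a *: z) = a ^+ 2 * A4 z, A5 (a *: z) = a ^+ 2 * A5 z
    & A6 (a *: z) = a ^+ 2 * A6 z].
Proof.
by split; split; rewrite /A0 /A1 /A2 /A3 /A4 /A5 /A6 /crd !mxE; ring.
Qed.

Lemma Psi2_scale (a : K) z : Psi2 (a *: z) = a ^+ 4 * Psi2 z.
Proof.
have [[t0 t1 t2 t3] [t4 t5 t6]] := A_scale a z.
by rewrite /Psi2 t0 t1 t2 t3 t4 t5 t6; ring.
Qed.

Lemma W_scale (a : K) c d z : W c d (a *: z) = a ^+ 4 * W c d z.
Proof.
have [[t0 t1 t2 t3] [t4 t5 t6]] := A_scale a z.
by rewrite /W; case: ifP => _; rewrite /phi t0 ?t1 ?t2 ?t3 ?t4 ?t5 ?t6; ring.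
Qed.

End SenaryAction.

(** * Invariance of [Psi2] under PSL(2,13) and of [A0] squared under the Borel subgroup *)

Section Invariance.
Variable R : realType.
Local Notation C := R[i].
Local Notation zeta := (zeta13 R).
Local Notation r13 := ((Num.sqrt 13 : R)%:C%C)^-1.

Lemma cexpX (w : C) n : cexp w ^+ n = cexp (n%:R * w).
Proof.
elim: n => [|n IHn].
  by rewrite expr0 mul0r /cexp /= expR0 cos0 sin0; simpc.
by rewrite exprS IHn -cexpD -natr1 mulrDl mul1r addrC.
Qed.

Lemma zeta13E : zeta = cexp (Complex 0 (2 * pi / 13 : R)).
Proof.
congr cexp; rewrite -[13 : C](rmorph_nat (real_complex R)) -fmorphV.
rewrite -[2 : C](rmorph_nat (real_complex R)) /=; simpc.
by congr Complex; ring.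
Qed.

Lemma zeta13_expr13 : zeta ^+ 13 = 1.
Proof.
rewrite zeta13E cexpX -[13%:R : C](rmorph_nat (real_complex R)) /=.
have -> : (13%:R)%:C%C * Complex 0 (2 * pi / 13) = Complex 0 (pi *+ 2) :> C.
  by simpc; congr Complex; rewrite -mulr_natl; field.
by rewrite /cexp /= expR0 cos2pi sin2pi; simpc.
Qed.

Lemma zeta13_neq1 : zeta != 1.
Proof.
rewrite zeta13E /cexp /= expR0 mul1r eq_complex /= negb_and orbC gt_eqF //.
have p0 := pi_gt0 R; apply: sin_gt0_pi; apply/andP; split; lra.
Qed.

Lemma zeta13_cyclo : zeta ^+ 12 = - (1 + zeta + zeta ^+ 2 + zeta ^+ 3 + zeta ^+ 4
  + zeta ^+ 5 + zeta ^+ 6 + zeta ^+ 7 + zeta ^+ 8 + zeta ^+ 9 + zeta ^+ 10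
  + zeta ^+ 11).
Proof.
have := zeta13_expr13; move: zeta zeta13_neq1 => x x1 x13.
have x10 : x - 1 != 0 by rewrite subr_eq0.
apply/eqP; rewrite -subr_eq0 opprK; apply/eqP/(mulfI x10).
by rewrite mulr0 -[RHS](subrr 1) -[X in _ = X - _]x13; ring.
Qed.

(** Cancels the 169 that quartic forms acquire under [Stab]. *)
Lemma r13_expr4 : (- r13) ^+ 4 * 169 = 1 :> C.
Proof.
have s2 : (Num.sqrt 13 : R)%:C%C ^+ 2 = 13 :> C.
  by rewrite -rmorphXn /= sqr_sqrtr ?ler0n // rmorph_nat.
have s0 : (Num.sqrt 13 : R)%:C%C != 0 :> C.
  by apply/eqP => h; move: s2; rewrite h expr0n /= => /eqP; rewrite eq_sym pnatr_eq0.
have -> : 169 = 13 ^+ 2 :> C by ring.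
rewrite -s2 -exprM -[X in X ^+ 4]mulN1r exprMn -signr_odd mul1r exprVn.
by rewrite mulVf // expf_neq0.
Qed.

Lemma SmxE : Smx R = (- r13) *: Stab zeta.
Proof. by apply/matrixP => i j; rewrite !mxE. Qed.

Lemma TmxE : Tmx R = Tdiag zeta.
Proof. by []. Qed.

Lemma Smx_unit : Smx R \in unitmx.
Proof.
have cN0 : (13 : C) != 0 by rewrite pnatr_eq0.
have r0 : - r13 != 0 :> C.
  apply/eqP => h; have := r13_expr4; rewrite h expr0n mul0r.
  by move/eqP; rewrite eq_sym oner_eq0.
rewrite SmxE unitmxZ ?unitfE //.
have [|] := @mulmx1_unit _ _ (Stab zeta) ((- 13)^-1 *: Stab zeta); last by [].
by rewrite -scalemxAr (Stab2 zeta13_cyclo) scale_scalar_mx mulVf // oppr_eq0.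
Qed.

Lemma Tmx_unit : Tmx R \in unitmx.
Proof.
have z0 : zeta != 0.
  apply/eqP => h; have := zeta13_expr13; rewrite h expr0n => /eqP.
  by rewrite eq_sym oner_eq0.
have -> : Tmx R = diag_mx (\row_i zeta ^+ nth 0%N [:: 7; 11; 8; 6; 2; 5]%N i).
  by apply/matrixP => i j; rewrite !mxE.
rewrite unitmxE det_diag unitfE; apply/prodf_neq0 => i _.
by rewrite mxE expf_neq0.
Qed.

Lemma Psi2_PSL : @PSL_invariant R PSL2_13 (@Psi2 C).
Proof.
move=> x M _; elim=> {x M} [|||M N x y _ IHM _ IHN|M x _ IHM] z.
- rewrite SmxE -scalemxAl Psi2_scale (Psi2_Stab zeta13_cyclo) mulrA.
  by rewrite r13_expr4 mul1r.
- by rewrite TmxE (Psi2_Tdiag zeta13_cyclo).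
- by rewrite mul1mx.
- by rewrite -mulmxA IHM IHN.
(* A singular [M] equals its [invmx], so that case is the induction hypothesis. *)
have [uM|uM] := boolP (M \in unitmx); last by rewrite invmx_out.
by rewrite -[in RHS](mulKVmx uM z) IHM.
Qed.

Lemma row_mulg (g h : {'GL_2(13)}) (c d : 'F_13) j :
  c * GLval (g * h)%g 0 j + d * GLval (g * h)%g 1 j =
  (c * GLval g 0 0 + d * GLval g 1 0) * GLval h 0 j
  + (c * GLval g 0 1 + d * GLval g 1 1) * GLval h 1 j.
Proof. by rewrite GL_MxE !mulmx2E; ring. Qed.

Lemma row_mul1 (c d : 'F_13) : let e := GLval (1%g : {'GL_2(13)}) in
  (c * e 0 0 + d * e 1 0 = c) * (c * e 0 1 + d * e 1 1 = d).
Proof. by move=> e; rewrite /e GL_1E !mxE /= !(mulr0, mulr1, add0r, addr0). Qed.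

Lemma row_mulg_neq0 (g : {'GL_2(13)}) (c d : 'F_13) : (c, d) != (0, 0) ->
  (c * GLval g 0 0 + d * GLval g 1 0, c * GLval g 0 1 + d * GLval g 1 1) != (0, 0).
Proof.
rewrite !xpair_eqE; apply: contra => /andP[/eqP c0 /eqP d0]; apply/andP; split.
  by rewrite -[c](row_mul1 c d).1 -(mulgV g) row_mulg c0 d0 !mul0r addr0.
by rewrite -[d](row_mul1 c d).2 -(mulgV g) row_mulg c0 d0 !mul0r addr0.
Qed.

(** A representative M of x permutes the squares [W] as some lift g of x in SL(2,13) acts on row
    vectors from the right. The lift is built along with M, generator by generator. *)
Lemma W_PSL_acts M x : PSL_acts M x -> M \in unitmx /\
  exists2 g, g \in SL2_13 /\ x = coset 'Z(SL2_13)%g g &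
  forall c d z, (c, d) != (0, 0) -> W zeta c d (M *m z) =
   W zeta (c * GLval g 0 0 + d * GLval g 1 0) (c * GLval g 0 1 + d * GLval g 1 1) z.
Proof.
have nZ g : g \in SL2_13 -> g \in 'N('Z(SL2_13))%g.
  exact: (fintype.subsetP SL_norm_center).
elim=> {x M} [|||M N x y _ [uM [g [gS ->] hM]] _ [uN [h [hS ->] hN]]
    |M x _ [uM [g [gS ->] hM]]].
- split; first exact: Smx_unit.
  exists sgen; first by split=> //; exact: sgen_SL.
  move=> c d z cd; rewrite SmxE -scalemxAl W_scale (W_Stab zeta13_cyclo) // mulrA.
  by rewrite r13_expr4 mul1r !mxE /= !(mulr0, mulr1, mulrN1, add0r, addr0) //.
- split; first exact: Tmx_unit.
  exists tgen; first by split=> //; exact: tgen_SL.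
  move=> c d z cd; rewrite TmxE (W_Tdiag zeta13_cyclo) !mxE /=.
  by rewrite !(mulr0, mulr1, mulrN1, add0r, addr0).
- split; first exact: unitmx1.
  exists 1%g; first by rewrite morph1 (group1 SL2_13_group).
  by move=> c d z cd; rewrite mul1mx !row_mul1.
- split; first by rewrite unitmx_mul uM.
  exists (g * h)%g; first by rewrite (@groupM _ SL2_13_group) // morphM ?nZ.
  move=> c d z cd; rewrite -mulmxA hM // hN; last exact: row_mulg_neq0.
  by rewrite !row_mulg.
split; first by rewrite unitmx_inv.
exists g^-1%g; first by rewrite (groupVr (G := SL2_13_group)) // morphV ?nZ.
(* The case of g is applied to the row (c, d) g^-1 and the vector M^-1 z. *)
move=> c d z cd; have := hM _ _ (invmx M *m z) (row_mulg_neq0 g^-1%g cd).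
by rewrite mulKVmx // -!row_mulg mulVg !row_mul1.
Qed.

Lemma A0_sqr_Borel : @PSL_invariant R Borel_PSL2_13 (fun z => A0 z ^+ 2).
Proof.
move=> x M xB /W_PSL_acts[_ [g [gS xE] hW]] z.
have /morphimP[b _ bB xb] := xB.
have := coset_Borel gS bB (etrans (esym xE) xb).
rewrite in_Borel gS => /eqP c0.
(* The row (0, 1) represents infinity; g is upper triangular, so its image again has first entry 0
   and both sides are 13 A0^2. *)
have := hW 0 1 z; rewrite xpair_eqE oner_eq0 andbF c0 !mul0r !add0r mulr0 => /(_ isT).
by rewrite /W eqxx => /(mulfI (_ : 13 != 0))-> //; rewrite pnatr_eq0.
Qed.

End Invariance.

Theorem theorem1p3 (R : realType) :
  [/\ (* the quotient is meaningful: its denominator is not identically zero *)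
      (exists z : R[i], upper_half_plane z /\ A0 (avec z) != 0),
      (forall z : R[i], upper_half_plane z -> A0 (avec z) != 0 ->
         Psi2 (avec z) / A0 (avec z) ^+ 2 = 0),
      @PSL_invariant R PSL2_13 (@Psi2 R[i])
    & [/\ maximal Borel_PSL2_13 PSL2_13,
          #|Borel_PSL2_13| = 78%N
        & @PSL_invariant R Borel_PSL2_13 (fun z => A0 z ^+ 2)]].
Proof.
split; [exact: A0_avec_neq0 | | exact: Psi2_PSL | split].
- by move=> z zH _; rewrite Psi2_avec // mul0r.
- exact: maximal_Borel_PSL.
- exact: card_Borel_PSL.
- exact: A0_sqr_Borel.
Qed.
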